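(* Let $d,D\in\mathbb{N}_{+}$ and $s\in\mathbb{N}$ with $d\geq\max\{s+10,11\}$, and let $\delta>0$. There exists a constant $c\in(0,1]$ depending only on $s$, and a constant $p_{0}$ depending only on $\delta,d,D$, such that the following holds for every prime $p\ge p_{0}$. Let $M\colon\mathbb{F}_{p}^{d}\to\mathbb{F}_{p}$ be a non-degenerate quadratic form and let $P\subseteq\mathbb{F}_{p}^{d}$ be a proper homogeneous generalized arithmetic progression of rank $D$ with $|P|>\delta p^{d}$. If $\xi\colon P\to\mathrm{HP}_{d}(s)$ satisfies $$\xi(h_{1})+\xi(h_{2})-\xi(h_{3})-\xi(h_{4})\in J^{M}_{h_{1},h_{2},h_{3}}\quad\text{for all }h_{1},h_{2},h_{3},h_{4}\in P\text{ with }h_{1}+h_{2}=h_{3}+h_{4},$$ then there is a locally linear map $T\colon P(c)\to\mathrm{HP}_{d}(s)$ such that $\xi(h)-T(h)\in J^{M}_{h}$ for all $h\in P(c)$.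
   Context: $\mathrm{HP}_{d}(s)$ is the set of homogeneous degree-$s$ polynomials in $\mathbb{F}_{p}[x_{1},\dots,x_{d}]$ together with $0$. A quadratic form is $M(n)=(nA)\cdot n+n\cdot u+v$ with $A$ symmetric over $\mathbb{F}_{p}$ (row vectors), non-degenerate if $\det A\ne 0$; $J^{M}_{h_{1},\dots,h_{k}}$ is the ideal of $\mathbb{F}_{p}[x_{1},\dots,x_{d}]$ generated by $n\mapsto(nA)\cdot n$ and $n\mapsto(h_{i}A)\cdot n$, $n=(x_{1},\dots,x_{d})$. A homogeneous generalized arithmetic progression of rank $D$ is a set $P=\{\ell_{1}v_{1}+\dots+\ell_{D}v_{D}\colon \ell_{i}\in\mathbb{Z}\cap(-L_{i},L_{i})\}$ with $v_{i}\in\mathbb{F}_{p}^{d}$, $L_{i}>0$; it is proper if all these sums are distinct. For $0<c\le1$, $P(c)=\{\ell_{1}v_{1}+\dots+\ell_{D}v_{D}\colon \ell_{i}\in\mathbb{Z}\cap(-cL_{i},cL_{i})\}$. A map $T\colon P(c)\to\mathrm{HP}_{d}(s)$ is locally linear if there are $f_{0},\dots,f_{D}\in\mathrm{HP}_{d}(s)$ with $T(\ell_{1}v_{1}+\dots+\ell_{D}v_{D})=f_{0}+\ell_{1}f_{1}+\dots+\ell_{D}f_{D}$ for all admissible $\ell_{i}$. *)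

(* Defs.v *)
From HB Require Import structures.
From mathcomp Require Import all_boot all_order all_algebra.
From mathcomp Require Import mpoly.
From mathcomp Require Import boolp reals.

Set Implicit Arguments.
Unset Strict Implicit.
Unset Printing Implicit Defensive.

Import Order.TTheory GRing.Theory Num.Theory.
Local Open Scope ring_scope.

Section Defs.
Variables (p d : nat).

Local Notation F := 'F_p.
Local Notation vec := 'rV[F]_d.
Local Notation poly := {mpoly F[d]}.

(* HP_d(s): homogeneous polynomials of degree s together with 0
   (in mpoly, 0 is s.-homog for every s). *)
Definition HP (s : nat) (f : poly) : Prop := f \is s.-homog.

Definition quad_part (A : 'M[F]_d) : poly :=
  \sum_(i < d) \sum_(j < d) A i j *: ('X_i * 'X_j).

Definition lin_part (A : 'M[F]_d) (h : vec) : poly :=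
  \sum_(j < d) (h *m A) 0 j *: 'X_j.

Definition inJ (A : 'M[F]_d) (hs : seq vec) (f : poly) : Prop :=
  exists (g0 : poly) (g : nat -> poly),
    f = g0 * quad_part A + \sum_(i < size hs) g i * lin_part A (nth 0 hs i).

Variables (D : nat) (R : realType).

Definition admissible (L : 'I_D -> R) (c : R) (l : 'I_D -> int) : Prop :=
  forall i, `|(l i)%:~R| < c * L i.

Definition gap_elt (v : 'I_D -> vec) (l : 'I_D -> int) : vec :=
  \sum_(i < D) (v i *~ l i).

Definition inGAP (v : 'I_D -> vec) (L : 'I_D -> R) (c : R) (x : vec) : Prop :=
  exists l, admissible L c l /\ x = gap_elt v l.

Definition GAPset (v : 'I_D -> vec) (L : 'I_D -> R) (c : R) : {set vec} :=
  [set x | `[< inGAP v L c x >] ].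

Definition GAP_params (L : 'I_D -> R) : Prop := forall i, 0 < L i.

Definition proper_GAP (v : 'I_D -> vec) (L : 'I_D -> R) : Prop :=
  forall l l', admissible L 1 l -> admissible L 1 l' ->
    gap_elt v l = gap_elt v l' -> forall i, l i = l' i.

Definition locally_linear (s : nat) (v : 'I_D -> vec) (L : 'I_D -> R) (c : R)
    (T : vec -> poly) : Prop :=
  exists f : 'I_D.+1 -> poly,
    (forall i, HP s (f i)) /\
    forall l, admissible L c l ->
      T (gap_elt v l) = f ord0 + \sum_(i < D) (f (lift ord0 i) *~ l i).

End Defs.

(* Main.v *)
Require Import Defs.
From HB Require Import structures.
From mathcomp Require Import all_boot all_order all_algebra all_field.
From mathcomp Require Import mpoly.
From mathcomp Require Import boolp reals.
From mathcomp Require Import zify ring lra.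

Set Implicit Arguments.
Unset Strict Implicit.
Unset Printing Implicit Defensive.

Import Order.TTheory GRing.Theory Num.Theory.
Local Open Scope ring_scope.

(* Put phi(h) = xi(h) - xi(0) and L_h(n) = (hA).n, so that phi(a + b) = phi(a) + phi(b)
   modulo J_{a,b}. Linear forms L_h with h outside the span of hs are nonzero divisors
   modulo J_hs, hence a polynomial of degree s that vanishes modulo s + 1 pairwise
   independent L_h vanishes modulo the quadric, and a Chinese remainder theorem holds.
   Gluing the values t_x + phi(h - x) modulo L_{h-x} at generic points x gives T with
   T(h) - T(h') = phi(h - h') modulo L_{h-h'} for all h, h'. Such a T is only determined
   up to adding a polynomial in L_h. Differences of T of order s + 2 in generic directions
   vanish, hence so do those in equal directions, and i |-> T(ih) is a polynomial sequence;
   let C(h) be its coefficient of i. Then C(ih) = i C(h), and modulo L_{h-ik}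
   C(h + k) = (i + 1) C(k) + phi(h - ik) = C(k) + C(h); taking i = 0, ..., s shows
   that C is additive, and C(h) = phi(h) modulo L_h. *)

(** * Linear forms, linear substitutions and ideals generated by linear forms *)

Section LinearSubstitution.
Variables (p d : nat).
Local Notation F := 'F_p.
Local Notation vec := 'rV[F]_d.
Local Notation poly := {mpoly F[d]}.
Implicit Types (P : 'M[F]_d) (f g : poly) (x : vec).

(** [lin_part A h] unfolds to [lform (h *m A)], so statements about the forms L_h become linear
    algebra on coefficient vectors. *)
Definition lform x : poly := \sum_j x 0 j *: 'X_j.

(** Pullback of [f] along the endomorphism x -> x P of row vectors. *)
Definition lsub P (f : poly) : poly :=
  f \mPo [tuple \sum_i P i j *: 'X_i | j < d].

Lemma lformD x y : lform (x + y) = lform x + lform y.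
Proof. by rewrite -big_split /=; apply: eq_bigr => j _; rewrite mxE scalerDl. Qed.

Lemma lformZ a x : lform (a *: x) = a *: lform x.
Proof. by rewrite scaler_sumr; apply: eq_bigr => j _; rewrite mxE scalerA. Qed.

Lemma lform0 : lform 0 = 0.
Proof. by rewrite -(scale0r 0) lformZ !scale0r. Qed.

Lemma lformB x y : lform (x - y) = lform x - lform y.
Proof. by rewrite -scaleN1r lformD lformZ scaleN1r. Qed.

Lemma lform_homog x : lform x \is 1.-homog.
Proof.
by rewrite rpred_sum // => j _; apply: rpredZ; rewrite dhomogX; apply/eqP/mdeg1.
Qed.

Lemma lform_eq0 x : lform x = 0 -> x = 0.
Proof.
move=> x0; apply/rowP => j; rewrite mxE.
have /= := congr1 (mcoeff U_(j)) x0; rewrite linear_sum mcoeff0 /= (bigD1 j) //=.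
rewrite big1 => [|i ij]; last by rewrite mcoeffZ mcoeffXU (negPf ij) mulr0.
by rewrite addr0 mcoeffZ mcoeffXU eqxx mulr1.
Qed.

Lemma lsubX P j : lsub P 'X_j = \sum_i P i j *: 'X_i.
Proof. by rewrite /lsub comp_mpolyXU -tnth_nth tnth_mktuple. Qed.

Lemma lsub_lform P x : lsub P (lform x) = lform (x *m P^T).
Proof.
rewrite /lsub linear_sum /=.
under eq_bigr => j _ do rewrite comp_mpolyZ -/(lsub P _) lsubX scaler_sumr.
rewrite exchange_big; apply: eq_bigr => i _ /=.
rewrite mxE scaler_suml; apply: eq_bigr => j _.
by rewrite scalerA mxE.
Qed.

Lemma lsub_meval P f x : (lsub P f).@[x 0] = f.@[(x *m P) 0].
Proof.
rewrite comp_mpoly_meval; apply: meval_eq => j.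
rewrite tnth_mktuple linear_sum /= mxE; apply: eq_bigr => i _.
by rewrite mevalZ mevalXU mulrC.
Qed.

Definition span_ideal (ls : seq vec) (f : poly) : Prop :=
  exists g : nat -> poly, f = \sum_(i < size ls) g i * lform (nth 0 ls i).

Lemma span_ideal0 ls : span_ideal ls 0.
Proof. by exists (fun=> 0); rewrite big1 // => i _; rewrite mul0r. Qed.

Lemma span_idealD ls f g : span_ideal ls f -> span_ideal ls g -> span_ideal ls (f + g).
Proof.
move=> [u ->] [w ->]; exists (fun i => u i + w i).
by rewrite -big_split; apply: eq_bigr => i _; rewrite mulrDl.
Qed.

Lemma span_idealM ls f g : span_ideal ls g -> span_ideal ls (f * g).
Proof.
move=> [u ->]; exists (fun i => f * u i).
by rewrite mulr_sumr; apply: eq_bigr => i _; rewrite mulrA.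
Qed.

Lemma span_ideal_lform ls x : x \in <<ls>>%VS -> span_ideal ls (lform x).
Proof.
move=> /(@coord_span _ _ _ (in_tuple ls)) ->.
exists (fun i => if insub i is Some j then (coord (in_tuple ls) j x)%:MP else 0).
rewrite (big_morph lform lformD lform0).
apply: eq_bigr => i _; rewrite valK lformZ mul_mpolyC.
by congr (_ *: lform _); exact: set_nth_default.
Qed.

(** Substitution is a ring morphism, so a congruence between [f] and [lsub P f] passes from the
    variables to products, monomials and linear combinations. *)
Lemma span_ideal_lsub ls P f :
  (forall j, span_ideal ls ('X_j - lsub P 'X_j)) -> span_ideal ls (f - lsub P f).
Proof.
move=> XP.
have mulP g h : span_ideal ls (g - lsub P g) -> span_ideal ls (h - lsub P h) ->
    span_ideal ls (g * h - lsub P (g * h)).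
  move=> gP hP; rewrite /lsub rmorphM /= -!/(lsub _ _).
  have -> : g * h - lsub P g * lsub P h = h * (g - lsub P g) + lsub P g * (h - lsub P h).
    by rewrite mulrBr mulrBr addrA (mulrC h g) (mulrC h) subrK.
  by apply: span_idealD; exact: span_idealM.
have oneP : span_ideal ls (1 - lsub P 1).
  by rewrite /lsub rmorph1 subrr; exact: span_ideal0.
have monP m : span_ideal ls ('X_[m] - lsub P 'X_[m]).
  rewrite mpolyXE_id; apply: (big_ind (fun q => span_ideal ls (q - lsub P q))).
  - exact: oneP.
  - exact: mulP.
  move=> i _; elim: (m i) => [|k IHk]; first by rewrite expr0.
  rewrite exprS; apply: mulP; [exact: XP | exact: IHk].
elim/mpolyind: f => [|c m f _ _ IHf]; first by rewrite /lsub rmorph0 subr0; exact: span_ideal0.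
have -> : c *: 'X_[m] + f - lsub P (c *: 'X_[m] + f) =
    c%:MP * ('X_[m] - lsub P 'X_[m]) + (f - lsub P f).
  by rewrite /lsub linearP /= -!/(lsub _ _) -!mul_mpolyC mulrBr opprD addrACA.
apply: span_idealD; last exact: IHf.
by apply: span_idealM; exact: monP.
Qed.

(** Let B have the rows [ls] and let C be a right inverse of B. Then 1 - C B is a projection whose
    kernel on row vectors is the span of [ls]; substituting along its transpose sets exactly these
    forms to zero. The last two properties present the ideal as the kernel of a morphism into a
    domain, whence it is prime. *)
Lemma kill_linear_forms (ls : seq vec) : free ls ->
  exists P, [/\ (d - size ls <= \rank P)%N,
    forall x, x *m P^T = 0 -> x \in <<ls>>%VS,
    forall f, span_ideal ls (f - lsub P f) &
    forall f, span_ideal ls f -> lsub P f = 0].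
Proof.
move=> fls; pose B : 'M[F]_(size ls, d) := \matrix_i ls`_i.
have /row_freeP[C BC] : row_free B.
  apply: inj_row_free => u uB0; apply/rowP => i; rewrite mxE.
  have /freeP indep : free (in_tuple ls) by [].
  apply: (indep (fun i => u 0 i)); apply/rowP => j.
  have := congr1 (fun M : 'rV_d => M 0 j) uB0; rewrite !mxE summxE => E.
  by under eq_bigr => k _ do rewrite mxE; rewrite -[RHS]E; apply: eq_bigr => k _; rewrite !mxE.
have rowsB u : u *m B \in <<ls>>%VS.
  rewrite mulmx_sum_row; apply: rpred_sum => i _; apply/rpredZ/memv_span.
  by rewrite rowK mem_nth.
exists (1%:M - C *m B)^T; rewrite trmxK; split.
- rewrite mxrank_tr leq_subLR addnC -[leqLHS](mxrank1 F).
  rewrite -{1}(subrK (C *m B) 1%:M) (leq_trans (mxrank_add _ _)) // leq_add2l.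
  by rewrite (leq_trans (mxrankM_maxr _ _)) // rank_leq_row.
- move=> x; rewrite mulmxBr mulmx1 mulmxA => /eqP; rewrite subr_eq0 => /eqP ->.
  exact: rowsB.
- move=> f; apply: span_ideal_lsub => j.
  have {1 2}-> : 'X_j = lform (delta_mx 0 j).
    rewrite /lform (bigD1 j) //= big1 ?addr0 => [|i ij]; rewrite mxE eqxx.
      by rewrite eqxx scale1r.
    by rewrite (negPf ij) scale0r.
  rewrite lsub_lform trmxK mulmxBr mulmx1 lformB opprB addrC subrK mulmxA.
  by apply: span_ideal_lform; exact: rowsB.
- move=> f [g ->]; rewrite /lsub rmorph_sum big1 //= => i _.
  rewrite rmorphM /= -!/(lsub _ _) lsub_lform trmxK.
  have -> : ls`_i = row i B by rewrite rowK.
  rewrite -row_mul mulmxBr mulmx1 mulmxA BC mul1mx subrr.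
  by rewrite row0 lform0 mulr0.
Qed.

End LinearSubstitution.

(** * Reading off the linear coefficient of a polynomial sequence *)

(** Induction by (l + 1) C(i, l + 1) = (i - l) C(i, l); the hypothesis makes the denominators
    invertible. *)
Lemma binomial_poly (F : fieldType) l : (forall i, (0 < i <= l)%N -> i%:R != 0 :> F) ->
  exists2 b : {poly F}, (size b <= l.+1)%N & forall i, b.[i%:R] = 'C(i, l)%:R.
Proof.
elim: l => [|l IH] charF.
  by exists 1 => [|i]; rewrite ?size_poly1 // hornerC bin0.
have [|b sb bE] := IH; first by move=> i /andP[i0 il]; rewrite charF // i0 leqW.
exists (l.+1%:R^-1 *: (b * ('X - l%:R%:P))) => [|i].
  rewrite (leq_trans (size_scale_leq _ _)) // (leq_trans (size_polyMleq _ _)) //.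
  by rewrite size_XsubC addn2.
rewrite hornerZ hornerM bE hornerXsubC; apply: (mulfI (charF l.+1 _)); first by rewrite ltnS leqnn.
rewrite mulVKf ?charF ?leqnn // -natrM mul_bin_left natrM mulrC.
by case: (leqP l i) => li; [rewrite natrB|rewrite bin_small // !(mulr0, mul0r)].
Qed.

(* On polynomial sequences of degree less than [n], [alpha] computes the coefficient of
   degree 1 from the first [n] values. *)
Lemma linear_coefficient (F : fieldType) n : (forall i, (0 < i < n)%N -> i%:R != 0 :> F) ->
  (1 < n)%N -> exists alpha beta : nat -> F, \sum_(i < n) alpha i * i%:R = 1 /\
  forall l j, (l < n)%N -> \sum_(i < n) alpha i * 'C(j * i, l)%:R = j%:R * beta l.
Proof.
move=> charF n1; pose a : 'rV[F]_n := \row_i (i : nat)%:R.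
have uV : Vandermonde n a \in unitmx.
  rewrite unitmxE unitfE det_Vandermonde; apply/prodf_neq0 => i _; apply/prodf_neq0 => j ij.
  rewrite !mxE -natrB ?(ltnW ij) //; apply: charF.
  by rewrite subn_gt0 ij (leq_ltn_trans (leq_subr _ _)).
(* The nodes 0, ..., n - 1 are distinct in F, so the moment conditions sum_i alpha_i i^j = [j = 1]
   for j < n can be solved. *)
pose e : 'cV[F]_n := \col_i (i == 1%N :> nat)%:R.
pose x := invmx (Vandermonde n a) *m e.
pose alpha i := if insub i is Some k then x k 0 else 0.
have alphaE j : (j < n)%N -> \sum_(i < n) alpha i * i%:R ^+ j = (j == 1%N)%:R.
  move=> jn; have := congr1 (fun M : 'cV_n => M (Ordinal jn) 0) (mulKVmx uV e).
  rewrite !mxE /= => <-; apply: eq_bigr => i _.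
  by rewrite /alpha valK !mxE mulrC.
have /choice[b bE] : forall l, exists b : {poly F}, (l < n)%N ->
    (size b <= n)%N /\ forall i, b.[i%:R] = 'C(i, l)%:R.
  move=> l; case: (ltnP l n) => [ln|_]; last by exists 0.
  have [|b sb bE] := @binomial_poly F l; last by exists b; split=> //; exact: leq_trans ln.
  by move=> i /andP[i0 il]; rewrite charF // i0 (leq_ltn_trans il).
(* [beta l] is the coefficient of X in the polynomial i -> C(i, l); replacing i by j i multiplies
   this coefficient by j. *)
exists alpha, (fun l => (b l)`_1); split.
  by rewrite -[RHS](alphaE 1%N n1); apply: eq_bigr => i _; rewrite expr1.
move=> l j ln; have [sb blE] := bE l ln.
under eq_bigr => i _ do rewrite -blE natrM (horner_coef_wide _ sb) mulr_sumr.
rewrite exchange_big /= (bigD1 (Ordinal n1)) //= [X in _ + X]big1 ?addr0 => [|k k1].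
  under eq_bigr => i _ do rewrite mulrCA /= exprMn (mulrCA _ (j%:R ^+ 1)).
  by rewrite -!mulr_sumr (alphaE 1%N n1) mulr1 mulrC expr1.
under eq_bigr => i _ do rewrite exprMn mulrCA (mulrCA _ (j%:R ^+ k)).
rewrite -!mulr_sumr alphaE //; have -> : (k == 1%N :> nat) = false.
  by apply/negbTE; apply: contraNN k1 => /eqP k1; apply/eqP/val_inj.
by rewrite !mulr0.
Qed.

(** * Linear independence of translated families *)

Section FreeFamilies.
Variables (F : fieldType) (V : vectType F).
Implicit Types (h k w : V) (X Y ws : seq V) (U : {vspace V}).

Lemma free_sub X Y : free X -> uniq Y -> {subset Y <= X} -> free Y.
Proof.
move=> fX uY YX; rewrite (perm_free (Y := [seq x <- X | x \in Y])) ?filter_free //.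
apply: uniq_perm => // [|x]; first by rewrite filter_uniq // (free_uniq fX).
rewrite mem_filter.
by case: (boolP (x \in Y)) => // /YX ->.
Qed.

Lemma free_of_span X Y : free X -> {subset X <= <<Y>>%VS} -> (size Y <= size X)%N -> free Y.
Proof.
rewrite /free => /eqP fX /span_subvP /dimvS; rewrite fX => XY YX.
by rewrite eqn_leq dim_span (leq_trans YX).
Qed.

Lemma free_pairwise k X : free (k :: X) -> pairwise (fun a b => free [:: a; b; k]) X.
Proof.
move=> fX; have := free_uniq fX; rewrite cons_uniq => /andP[kX].
rewrite uniq_pairwise; apply: (@sub_in_pairwise _ (mem X)); last exact/allP.
move=> a b /= aX bX ab; apply: (free_sub fX).
  by rewrite /= !inE negb_or ab andbT; apply/andP; split;
    apply: contraNneq kX => <-.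
by move=> x; rewrite !inE => /or3P[]/eqP->; rewrite ?aX ?bX ?eqxx ?orbT.
Qed.

Lemma free_pairwise2 X : free X -> pairwise (fun a b => free [:: a; b]) X.
Proof.
move=> fX; have := free_uniq fX.
rewrite uniq_pairwise; apply: (@sub_in_pairwise _ (mem X)); last exact/allP.
move=> a b /= aX bX ab; apply: (free_sub fX).
  by rewrite /= !inE ab.
by move=> x; rewrite !inE => /orP[]/eqP->.
Qed.

(** Independence of [ws] modulo [U], in a form that suits choosing the vectors one at a time. *)
Fixpoint outside U ws : bool :=
  if ws is w :: ws' then (w \notin U + <<ws'>>)%VS && outside U ws' else true.

(** Modulo [U] the vector h - w is -w, so translating by [h] in [U] preserves independence modulo
    [U]. *)
Lemma free_outside U ws X h : outside U ws -> free X -> (<<X>> <= U)%VS -> h \in U ->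
  free ([seq h - w | w <- ws] ++ X).
Proof.
move=> + fX XU hU; elim: ws => //= w ws IH /andP[wU /IH fr].
rewrite free_cons fr andbT; apply: contra wU => hw.
rewrite -[w](subKr h) rpredB //; first exact: (subvP (addvSl _ _)).
apply: (subvP _ _ hw); apply/span_subvP => x; rewrite mem_cat => /orP[/mapP[k kws ->]|xX].
  by rewrite memv_add ?memvN ?memv_span.
by apply: (subvP (addvSl _ _)); apply: (subvP XU); exact: memv_span.
Qed.

(** Together with [h], the vectors h - x span everything that [h :: X] spans, and there are equally
    many of them. *)
Lemma free_shift h X : free (h :: X) -> free [seq h - x | x <- X].
Proof.
move=> fX; suff: free (h :: [seq h - x | x <- X]) by rewrite free_cons => /andP[].
apply: (free_of_span fX); rewrite /= ?size_map // => x.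
have hY : h \in <<h :: [seq h - x | x <- X]>>%VS by rewrite memv_span ?mem_head.
rewrite inE => /orP[/eqP-> //|xX]; rewrite -[x](subKr h) rpredB // memv_span //.
by rewrite inE (map_f (fun x => h - x)) ?orbT.
Qed.

Lemma free_rcons_shift h w X : free [seq h - x | x <- X] -> w \notin <<h :: X>>%VS ->
  free ([seq h - x | x <- X] ++ [:: h - w]).
Proof.
move=> fX wX; rewrite (perm_free (Y := h - w :: [seq h - x | x <- X])); last first.
  by rewrite perm_catC.
rewrite free_cons fX andbT; apply: contra wX => hw.
have hX : h \in <<h :: X>>%VS by rewrite memv_span ?mem_head.
rewrite -[w](subKr h) rpredB //; apply: (subvP _ _ hw); apply/span_subvP => y /mapP[x xX ->].
by rewrite rpredB // memv_span ?inE ?xX ?orbT.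
Qed.

End FreeFamilies.

(** * The ideals J: homogeneity and cancellation of linear forms *)

(** By linearity [g] may be taken to be a monomial. This serves to make the multipliers in a
    membership in J homogeneous. *)
Lemma pihomogM n (R : comNzRingType) t e (g q : {mpoly R[n]}) : q \is e.-homog ->
  pihomog mdeg t (g * q) = if (e <= t)%N then pihomog mdeg (t - e) g * q else 0.
Proof.
move=> qe; elim/mpolyind: g => [|c m f _ _ IHf].
  by rewrite mul0r !pihomog0 mul0r if_same.
rewrite mulrDl pihomogD IHf pihomogD -scalerAl !linearZ /=.
have mqh : 'X_[m] * q \is (mdeg m + e).-homog by apply: dhomogM; rewrite ?dhomogX.
case: (leqP e t) => et; last first.
  rewrite (pihomog_ne0 (d := mdeg m + e)) ?scaler0 ?addr0 //.
  by apply/eqP => E; move: et; rewrite -E ltnNge leq_addl.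
rewrite mulrDl -scalerAl; congr (_ *: _ + _).
rewrite pihomogX; case: eqP => [mt|/eqP mt].
  by rewrite pihomog_dE // -(subnK et) -mt.
rewrite mul0r (pihomog_ne0 (d := mdeg m + e)) //.
by apply: contraNneq mt => <-; rewrite addnK.
Qed.

Section QuadricIdeals.
Variables (p d : nat) (A : 'M['F_p]_d).
Hypotheses (p_pr : prime p) (p_odd : (2 < p)%N).
Hypotheses (A_sym : A^T = A) (A_det : \det A != 0).
Local Notation F := 'F_p.
Local Notation vec := 'rV[F]_d.
Local Notation poly := {mpoly F[d]}.
Local Notation J := (inJ A).
Local Notation L := (lin_part A).
Local Notation Q := (quad_part A).
Implicit Types (f g : poly) (h : vec) (hs : seq vec).

Let A_unit : A \in unitmx. Proof. by rewrite unitmxE unitfE. Qed.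

Lemma inJP hs f : J hs f <-> exists g0, span_ideal [seq h *m A | h <- hs] (f - g0 * Q).
Proof.
have E (g : nat -> poly) : \sum_(i < size hs) g i * L (nth 0 hs i) =
    \sum_(i < size [seq h *m A | h <- hs]) g i * lform [seq h *m A | h <- hs]`_i.
  by rewrite size_map; apply: eq_bigr => i _; rewrite (nth_map 0).
split=> [[g0 [g ->]]|[g0 [g E0]]].
  by exists g0; exists g; rewrite addrC addKr E.
by exists g0; exists g; rewrite E -E0 addrC subrK.
Qed.

Lemma inJ0 hs : J hs 0.
Proof. by apply/inJP; exists 0; rewrite mul0r subr0; exact: span_ideal0. Qed.

Lemma inJD hs f g : J hs f -> J hs g -> J hs (f + g).
Proof.
move=> /inJP[u fu] /inJP[w gw]; apply/inJP; exists (u + w).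
by rewrite mulrDl opprD addrACA; exact: span_idealD.
Qed.

Lemma inJM hs f g : J hs g -> J hs (f * g).
Proof.
move=> /inJP[u fu]; apply/inJP; exists (f * u).
by rewrite -mulrA -mulrBr; exact: span_idealM.
Qed.

Lemma inJ_quad hs : J hs Q.
Proof. by apply/inJP; exists 1; rewrite mul1r subrr; exact: span_ideal0. Qed.

Lemma mem_span_mulA hs h : h \in <<hs>>%VS -> h *m A \in <<[seq k *m A | k <- hs]>>%VS.
Proof.
move=> /(@coord_span _ _ _ (in_tuple hs)) ->; rewrite mulmx_suml.
apply: rpred_sum => i _; rewrite -scalemxAl; apply: rpredZ.
by apply: memv_span; apply: map_f; exact: mem_nth.
Qed.

Lemma mem_span_mulA_inv hs h : h *m A \in <<[seq k *m A | k <- hs]>>%VS -> h \in <<hs>>%VS.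
Proof.
move=> /(@coord_span _ _ _ (in_tuple [seq k *m A | k <- hs])) E.
rewrite -(mulmxK A_unit h) E mulmx_suml; apply: rpred_sum => i _.
have ih : (i < size hs)%N := leq_trans (ltn_ord i) (eq_leq (size_map _ _)).
rewrite -scalemxAl; apply/rpredZ.
by rewrite /= (nth_map 0) // mulmxK //; apply/memv_span/mem_nth.
Qed.

Lemma inJ_lin hs h : h \in <<hs>>%VS -> J hs (L h).
Proof.
move=> hhs; apply/inJP; exists 0; rewrite mul0r subr0.
by apply: span_ideal_lform; exact: mem_span_mulA.
Qed.

Lemma inJ_span hs hs' f : {subset hs <= <<hs'>>%VS} -> J hs f -> J hs' f.
Proof.
move=> sub [g0 [g ->]]; apply: inJD; first exact/inJM/inJ_quad.
elim/big_ind: _ => [||i _]; [exact: inJ0|exact: inJD|].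
by apply/inJM/inJ_lin/sub/mem_nth.
Qed.

Lemma inJ_pihomog hs t f : J hs f -> J hs (pihomog mdeg t f).
Proof.
have Qh : Q \is 2.-homog.
  rewrite rpred_sum // => i _; rewrite rpred_sum // => j _; apply: rpredZ.
  by rewrite -[2%N]/(1 + 1)%N; apply: dhomogM; rewrite dhomogX; apply/eqP/mdeg1.
move=> [g0 [g ->]]; rewrite linearD linear_sum /=; apply: inJD.
  by rewrite (pihomogM _ _ Qh); case: ifP => _; [exact/inJM/inJ_quad|exact: inJ0].
elim/big_ind: _ => [||i _]; [exact: inJ0|exact: inJD|].
rewrite (pihomogM _ _ (lform_homog _)); case: ifP => _; last exact: inJ0.
by apply/inJM/inJ_lin/memv_span/mem_nth.
Qed.

(** Take the component of degree t of f - g_0 L_h, where g_0 is the multiplier of L_h. In degree 0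
    the product g_0 L_h contributes nothing. *)
Lemma inJ_cons t h hs f : f \is t.-homog -> J (h :: hs) f ->
  if t is u.+1 then exists2 g : poly, g \is u.-homog & J hs (f - g * L h) else J hs f.
Proof.
move=> ft [g0 [g E]].
have: J hs (pihomog mdeg t (f - g 0%N * L h)).
  apply: inJ_pihomog; rewrite E big_ord_recl /= addrA addrAC addrK.
  by exists g0; exists (fun i => g i.+1).
rewrite linearB /= pihomog_dE // (pihomogM _ _ (lform_homog _)).
case: t ft => [_|u fu]; first by rewrite subr0.
by rewrite subn1 => JE; exists (pihomog mdeg u (g 0%N)) => //; exact: pihomogP.
Qed.

Lemma free_mulA hs : free hs -> free [seq h *m A | h <- hs].
Proof.
move=> fhs; have /freeP indep : free (in_tuple hs) by [].
have: free [tuple of map (fun h => h *m A) (in_tuple hs)].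
  apply/freeP => k E; apply: indep; apply: (can_inj (mulmxK A_unit)).
  rewrite /= mul0mx -[RHS]E mulmx_suml.
  by apply: eq_bigr => i _; rewrite (nth_map 0) ?scalemxAl.
by [].
Qed.

(** If the substitution killed the quadric, polarization in odd characteristic would give P A P^T =
    0. As A is invertible, the row space of P would then be totally isotropic and twice its
    dimension at most d. *)
Lemma quad_lsub_neq0 (P : 'M[F]_d) : (d < (\rank P).*2)%N -> lsub P Q != 0.
Proof.
move=> rP; apply/eqP => PQ0.
have quadE (x : vec) : Q.@[x 0] = (x *m A *m x^T) 0 0.
  rewrite raddf_sum /= mxE; under eq_bigr => i _ do rewrite raddf_sum.
  rewrite exchange_big; apply: eq_bigr => j _ /=.
  rewrite [in RHS]mxE mulr_suml; apply: eq_bigr => i _.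
  by rewrite mevalZ mevalM !mevalXU mxE mulrCA mulrA.
have z (x : vec) : (x *m (P *m A *m P^T) *m x^T) 0 0 = 0.
  have := lsub_meval P Q x; rewrite PQ0 meval0 quadE trmx_mul !mulmxA => <- //.
have M0 : P *m A *m P^T = 0.
  set M := P *m A *m P^T in z *.
  have MT : M^T = M by rewrite /M !trmx_mul trmxK A_sym mulmxA.
  apply/matrixP => i j; rewrite [RHS]mxE.
  have E k l : ((delta_mx 0 k : vec) *m M *m (delta_mx 0 l : vec)^T) 0 0 = M k l.
    by rewrite -rowE trmx_delta -colE !mxE.
  have := z (delta_mx 0 i + delta_mx 0 j).
  rewrite linearD /= !mulmxDl !mulmxDr mxE [X in X + _]mxE [X in _ + X]mxE !E.
  rewrite -[M i i]E -[M j j]E !z add0r addr0.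
  have -> : M j i = M i j by rewrite -{1}MT mxE.
  move=> /eqP.
  rewrite -mulr2n -mulr_natl mulf_eq0 => /orP[|/eqP //].
  by rewrite -(dvdn_pcharf (pchar_Fp p_pr)) gtnNdvd.
have := mulmx0_rank_max M0; rewrite mxrank_tr mxrankMfree -?addnn ?row_free_unit //.
by rewrite addnn leqNgt rP.
Qed.

(* Setting the forms of [h :: hs] to zero leaves the quadric nonzero, because an isotropic
   subspace has dimension at most d / 2; hence the multiplier of the quadric in
   [L h * f] lies in the ideal of these forms, and [L h] can be cancelled. *)
Lemma inJ_regular h hs f : (2 * (size hs).+1 < d)%N -> free (h :: hs) ->
  J hs (L h * f) -> J hs f.
Proof.
move=> dhs fh; have fhs : free hs by move: fh; rewrite free_cons => /andP[].
have [P [rP _ PI PK]] := kill_linear_forms (free_mulA fh).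
have [P' [_ kP' PI' PK']] := kill_linear_forms (free_mulA fhs).
have PQ : lsub P Q != 0.
  by apply: quad_lsub_neq0; move: rP; rewrite /= size_map; lia.
have spanL : span_ideal [seq k *m A | k <- h :: hs] (L h).
  by apply/span_ideal_lform/mem_span_mulA/memv_span/mem_head.
move=> /inJP[g0 Ig].
have g00 : lsub P g0 = 0.
  have : lsub P (L h * f - g0 * Q) = 0.
    case: Ig => g ->; apply: PK; exists (fun i => if i is j.+1 then g j else 0).
    by rewrite /= big_ord_recl mul0r add0r.
  rewrite /lsub rmorphB !rmorphM /= -!/(lsub _ _) (PK _ spanL) mul0r sub0r.
  move=> /eqP; rewrite oppr_eq0.
  rewrite mulf_eq0 => /orP[/eqP E|/idPn]; first exact: E.
  by rewrite PQ.
have [u Iu] : exists u, span_ideal [seq k *m A | k <- hs] (g0 - u * L h).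
  have [g] := PI g0; rewrite g00 subr0 => ->; exists (g 0%N); exists (fun i => g i.+1).
  by rewrite /= big_ord_recl addrC addKr.
apply/inJP; exists u.
have : span_ideal [seq k *m A | k <- hs] (L h * (f - u * Q)).
  have -> : L h * (f - u * Q) = (L h * f - g0 * Q) + Q * (g0 - u * L h).
    rewrite mulrBr (mulrBr Q) addrA (mulrC Q g0) subrK; congr (_ - _).
    by rewrite mulrC (mulrC u) -mulrA (mulrC u).
  by apply: span_idealD; [exact: Ig | apply: span_idealM; exact: Iu].
(* The ideal of the forms of [hs] is prime and, by freeness, does not contain L_h, so it contains f
   - u Q. *)
move=> /PK'; rewrite /lsub rmorphM /= -!/(lsub _ _) => /eqP; rewrite mulf_eq0 => /orP[/eqP|].
  rewrite lsub_lform => /lform_eq0/kP'/mem_span_mulA_inv hhs.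
  by move: fh; rewrite free_cons hhs.
by move=> /eqP E; have := PI' (f - u * Q); rewrite E subr0.
Qed.
End QuadricIdeals.

(** * Vanishing and Chinese remainders in an abstract family of graded ideals *)

Section IdealFamily.
Variables (F : fieldType) (V : vectType F) (S : comAlgType F).
(* [HP t] stands for the homogeneous elements of degree [t], [J hs] for the ideal generated
   by the quadric and the linear forms [L h], [h \in hs]. *)
Variables (HP : nat -> S -> Prop) (L : V -> S) (J : seq V -> S -> Prop).
Hypothesis HP0 : forall t, HP t 0.
Hypothesis HPD : forall t f g, HP t f -> HP t g -> HP t (f + g).
Hypothesis HPZ : forall t (c : F) f, HP t f -> HP t (c *: f).
Hypothesis HPM : forall t u f g, HP t f -> HP u g -> HP (t + u) (f * g).
Hypothesis HPL : forall h, HP 1 (L h).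
Hypothesis HP1 : HP 0 1.
Hypothesis J0 : forall hs, J hs 0.
Hypothesis JD : forall hs f g, J hs f -> J hs g -> J hs (f + g).
Hypothesis JM : forall hs f g, J hs g -> J hs (f * g).
Hypothesis JL : forall hs h, h \in hs -> J hs (L h).
Hypothesis J_span : forall hs hs' f, {subset hs <= <<hs'>>%VS} -> J hs f -> J hs' f.
Hypothesis J_cons : forall t h hs f, HP t f -> J (h :: hs) f ->
  if t is u.+1 then exists2 g, HP u g & J hs (f - g * L h) else J hs f.
Hypothesis J_regular : forall h hs f, (size hs <= 2)%N -> free (h :: hs) ->
  J hs (L h * f) -> J hs f.
Implicit Types (f g : S) (h k : V) (hs ks : seq V).

Lemma JN hs f : J hs f -> J hs (- f).
Proof. by move=> /(JM (-1)); rewrite mulN1r. Qed.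

Lemma JB hs f g : J hs f -> J hs g -> J hs (f - g).
Proof. by move=> Jf /JN; exact: JD. Qed.

Lemma JZ hs (c : F) f : J hs f -> J hs (c *: f).
Proof. by move=> /(JM c%:A); rewrite -scalerAl mul1r. Qed.

Lemma HPN t f : HP t f -> HP t (- f).
Proof. by move=> /(HPZ (-1)); rewrite scaleN1r. Qed.

Lemma HPB t f g : HP t f -> HP t g -> HP t (f - g).
Proof. by move=> Hf /HPN; exact: HPD. Qed.

(** Write f = g L_k modulo J_hs for the first k. For any other k' the product g L_k lies in
    J_{k',hs}, and L_k cancels there, so [g] satisfies the same hypotheses with degree and number of
    forms lowered by one. If the degree runs out first, [f] itself lies in J_hs. *)
Lemma factor_out hs ks t f : (size hs <= 1)%N -> HP t f ->
  {in ks, forall k, J (k :: hs) f} -> pairwise (fun a b => free [:: a, b & hs]) ks ->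
  if (size ks <= t)%N then
    exists2 g, HP (t - size ks) g & J hs (f - g * \prod_(k <- ks) L k)
  else J hs f.
Proof.
move=> shs; elim: ks t f => [|k ks IH] t f Hf Jf.
  by move=> _ /=; exists f; rewrite ?subn0 // big_nil mulr1 subrr.
rewrite pairwise_cons => /andP[/allP fk pks].
have kks : k \in k :: ks by rewrite mem_head.
have := J_cons Hf (Jf k kks); case: t Hf => [//|u] Hf [g Hg Jg].
have /IH : {in ks, forall k', J (k' :: hs) g}.
  move=> k' k'ks; apply: (J_regular (h := k)); rewrite ?ltnS //; first exact: fk.
  have -> : L k * g = f - (f - g * L k) by ring.
  apply: JB; first by apply: Jf; rewrite inE k'ks orbT.
  by apply: J_span Jg => x xhs; rewrite memv_span // inE xhs orbT.
move=> /(_ u Hg pks); rewrite [size _]/= ltnS; case: ifP => _.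
  move=> [q Hq Jq]; exists q; first by rewrite subSS.
  rewrite big_cons.
  have -> : f - q * (L k * \prod_(k <- ks) L k) =
    (f - g * L k) + L k * (g - q * \prod_(k <- ks) L k) by ring.
  by apply: JD => //; exact: JM.
move=> Jg'; rewrite -[f](subrK (g * L k)); apply: JD => //.
by rewrite mulrC; exact: JM.
Qed.

Lemma vanish hs ks t f : (size hs <= 1)%N -> HP t f -> (t < size ks)%N ->
  {in ks, forall k, J (k :: hs) f} -> pairwise (fun a b => free [:: a, b & hs]) ks -> J hs f.
Proof. by move=> shs Hf; rewrite ltnNge => /negPf ts Jf /(factor_out shs Hf Jf); rewrite ts. Qed.

(** Congruences are added one at a time. Modulo L_k, the solution [f] for the other forms differs
    from tau(k) by something that vanishes modulo each of these forms, hence by g times their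
    product. Subtracting this multiple corrects [f] at k and changes nothing modulo the other forms;
    if there are more than t of them, [f] is already correct. *)
Lemma chinese ks t (tau : V -> S) : free ks -> {in ks, forall k, HP t (tau k)} ->
  {in ks &, forall k k', J [:: k; k'] (tau k - tau k')} ->
  exists2 f, HP t f & {in ks, forall k, J [:: k] (f - tau k)}.
Proof.
elim: ks => [|k ks IH] fks Ht Jt; first by exists 0.
have /IH[||f Hf Jf] : free ks by move: fks; rewrite free_cons => /andP[].
- by move=> k' k'ks; apply: Ht; rewrite inE k'ks orbT.
- by move=> k1 k2 k1ks k2ks; apply: Jt; rewrite inE ?k1ks ?k2ks orbT.
have Htk : HP t (tau k) by apply: Ht; rewrite mem_head.
have J2 : {in ks, forall k', J [:: k'; k] (f - tau k)}.
  move=> k' k'ks; rewrite -[f](subrK (tau k')) -addrA; apply: JD.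
    apply: J_span (Jf k' k'ks) => x; rewrite !inE => /eqP->.
    by rewrite memv_span ?mem_head.
  by apply: Jt; rewrite ?mem_head // inE k'ks orbT.
have := factor_out (hs := [:: k]) isT (HPB Hf Htk) J2 (free_pairwise fks).
case: leqP => [tks [g Hg Jg]|_ Jk]; last first.
  by exists f => // k'; rewrite inE => /orP[/eqP-> //|]; exact: Jf.
have Hprod : HP (size ks) (\prod_(k <- ks) L k).
  by elim: (ks) => [|a l IHl]; rewrite ?big_nil // big_cons -[size _]add1n; exact: HPM.
exists (f - g * \prod_(k <- ks) L k).
  by apply: HPB => //; rewrite -(subnK tks); exact: HPM.
move=> k'; rewrite inE => /orP[/eqP->|k'ks]; first by rewrite addrAC.
rewrite addrAC; apply: JB; first exact: Jf.
rewrite (big_rem k') //= (mulrC (L k')) mulrA; apply: JM; apply: JL.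
by rewrite mem_head.
Qed.

Lemma J_span1 a hs f : a \in <<hs>>%VS -> J [:: a] f -> J hs f.
Proof. by move=> ah; apply: J_span => x; rewrite inE => /eqP->. Qed.

Lemma J_span2 a b hs f : a \in <<hs>>%VS -> b \in <<hs>>%VS -> J [:: a; b] f -> J hs f.
Proof. by move=> ah bh; apply: J_span => x; rewrite !inE => /orP[]/eqP->. Qed.

Lemma J_nil hs f : J [::] f -> J hs f.
Proof. exact: J_span. Qed.

(* [B n] stands for the progression dilated by n / (2m). *)
Variables (s d m : nat) (B : nat -> V -> Prop) (phi : V -> S).
Hypothesis sd : (s + 10 <= d)%N.
Hypothesis m_gt0 : (0 < m)%N.
Hypothesis B0 : B 1 0.
Hypothesis BD : forall n n' x y, B n x -> B n' y -> B (n + n') (x + y).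
Hypothesis BN : forall n x, B n x -> B n (- x).
Hypothesis B_le : forall n n' x, (n <= n')%N -> B n x -> B n' x.
Hypothesis avoid : forall Us : seq {vspace V}, (size Us <= d)%N ->
  all (fun U => (\dim U < d)%N) Us -> exists2 y, B 1 y & all (fun U : {vspace V} => y \notin U) Us.
Hypothesis phi_homog : forall h, B (m + m) h -> HP s (phi h).
Hypothesis phi_add : forall a b, B (m + m) a -> B (m + m) b -> B (m + m) (a + b) ->
  J [:: a; b] (phi (a + b) - phi a - phi b).

(** * Compatible values and their gluing to a global section *)

(** The relation required of T, for candidate values [t] at [x] and [u] at [y]. *)
Definition compat x (t : S) y (u : S) := J [:: x - y] (t - u - phi (x - y)).

Lemma B1m x : B 1 x -> B m x.
Proof. exact: B_le. Qed.

Lemma B_sub x y : B m x -> B m y -> B (m + m) (x - y).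
Proof. by move=> Bx /BN; exact: BD. Qed.

Lemma phi0 : J [::] (phi 0).
Proof.
have B2 : B (m + m) 0 by apply: B_le B0; rewrite addn_gt0 m_gt0.
have := phi_add B2 B2; rewrite addr0 => /(_ B2) JJ.
apply: (@J_span2 0 0); rewrite ?mem0v //.
rewrite -[phi 0]opprK; apply: JN.
by have -> : - phi 0 = phi 0 - phi 0 - phi 0 by ring.
Qed.

Lemma phiN x : B (m + m) x -> J [:: x] (phi (- x) + phi x).
Proof.
move=> Bx; have xx : x \in <<[:: x]>>%VS by rewrite memv_span ?mem_head.
have B2 : B (m + m) (x - x) by rewrite subrr; apply: B_le B0; rewrite addn_gt0 m_gt0.
have := phi_add Bx (BN Bx) B2; rewrite subrr => /(@J_span2 _ _ [:: x]).
rewrite memvN => /(_ xx xx) JJ.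
have -> : phi (- x) + phi x = phi 0 - (phi 0 - phi x - phi (- x)) by ring.
by apply: JB => //; apply: J_nil; exact: phi0.
Qed.

Lemma compat_sym x t y u : B m x -> B m y -> compat x t y u -> compat y u x t.
Proof.
move=> Bx By; rewrite /compat => Jc; apply: (@J_span1 (x - y)).
  by rewrite -[x - y]opprB memvN memv_span ?mem_head.
have JJ := phiN (B_sub Bx By).
have -> : u - t - phi (y - x) = - (t - u - phi (x - y)) - (phi (- (x - y)) + phi (x - y)).
  by rewrite (opprB x y); ring.
by apply: JB => //; exact: JN.
Qed.

Lemma compat_refl x t : compat x t x t.
Proof. by rewrite /compat !subrr sub0r; apply/JN/J_nil/phi0. Qed.

(** Compatibility with the points x prescribes T(x) + phi(h - x) modulo L_{h-x}. Additivity of phi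
    makes two such prescriptions agree modulo both forms, so the Chinese remainder theorem
    applies. *)
Lemma extend_compat xs (T : V -> S) h : B m h -> free [seq h - x | x <- xs] ->
  {in xs, forall x, B m x /\ HP s (T x)} ->
  {in xs &, forall x y, compat x (T x) y (T y)} ->
  exists2 t, HP s t & {in xs, forall x, compat h t x (T x)}.
Proof.
move=> Bh fxs HT CT; pose tau k := T (h - k) + phi k.
case: (@chinese [seq h - x | x <- xs] s tau) => //.
- move=> k /mapP[x /HT[Bx Hx] ->]; rewrite /tau subKr.
  by apply: HPD => //; apply: phi_homog; exact: B_sub.
- move=> k k' /mapP[x xxs ->] /mapP[y yxs ->]; rewrite /tau !subKr.
  have [Bx _] := HT x xxs; have [By _] := HT y yxs.
  set X := <<[:: h - x; h - y]>>%VS.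
  have hx : h - x \in X by rewrite memv_span ?mem_head.
  have hy : h - y \in X by rewrite memv_span // !inE eqxx orbT.
  have E : h - y = (h - x) + (x - y) by rewrite addrA subrK.
  have xy : x - y \in X by rewrite -[x - y](addKr (h - x)) -E rpredD ?memvN.
  have := phi_add (B_sub Bh Bx) (B_sub Bx By); rewrite -E => /(_ (B_sub Bh By)).
  move=> /(J_span2 hx xy) J1; have J2 := J_span1 xy (CT x y xxs yxs).
  have -> : T x + phi (h - x) - (T y + phi (h - y)) =
    (T x - T y - phi (x - y)) - (phi (h - y) - phi (h - x) - phi (x - y)) by ring.
  exact: JB.
move=> t Ht Jt; exists t => // x xxs; rewrite /compat.
have := Jt (h - x); rewrite /tau subKr opprD addrA; apply.
by apply: map_f.
Qed.

(** Passing through [z] costs the additional form L_{x-z}; varying [z] removes it in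
    [compat_of_common]. *)
Lemma compat_trans x t y u z r : B m x -> B m y -> B m z ->
  compat x t z r -> compat y u z r -> J [:: x - z; x - y] (t - u - phi (x - y)).
Proof.
move=> Bx By Bz Cx Cy; set X := <<[:: x - z; x - y]>>%VS.
have xz : x - z \in X by rewrite memv_span ?mem_head.
have xy : x - y \in X by rewrite memv_span // !inE eqxx orbT.
have E : x - z = (x - y) + (y - z) by rewrite addrA subrK.
have yz : y - z \in X by rewrite -[y - z](addKr (x - y)) -E rpredD ?memvN.
have := phi_add (B_sub Bx By) (B_sub By Bz); rewrite -E => /(_ (B_sub Bx Bz)).
move=> /(J_span2 xy yz) J1; have J2 := J_span1 xz Cx; have J3 := J_span1 yz Cy.
have -> : t - u - phi (x - y) =
  (t - r - phi (x - z)) - (u - r - phi (y - z)) + (phi (x - z) - phi (x - y) - phi (y - z)) by ring.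
by apply: JD => //; exact: JB.
Qed.

(** The defect has degree s and, modulo L_{h-h'}, vanishes modulo each of more than s independent
    forms L_{h-x}. *)
Lemma compat_of_common xs (T : V -> S) h t h' t' : B m h -> B m h' -> HP s t -> HP s t' ->
  (s < size xs)%N -> {in xs, forall x, B m x} ->
  free ([seq h - x | x <- xs] ++ [:: h - h']) ->
  {in xs, forall x, compat h t x (T x)} -> {in xs, forall x, compat h' t' x (T x)} ->
  compat h t h' t'.
Proof.
move=> Bh Bh' Ht Ht' sxs Bxs fxs Ct Ct'.
apply: (@vanish [:: h - h'] [seq h - x | x <- xs] s) => //.
- by apply: HPB; [exact: HPB|apply: phi_homog; exact: B_sub].
- by rewrite size_map.
- by move=> k /mapP[x xxs ->]; apply: (compat_trans Bh Bh' (Bxs x xxs)); [exact: Ct|exact: Ct'].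
- apply: free_pairwise; rewrite (perm_free (Y := [seq h - x | x <- xs] ++ [:: h - h'])) //.
  by rewrite perm_sym perm_catC.
Qed.

(** Each new vector has to avoid [Us] and the span of [U] with the vectors already chosen: at most d
    proper subspaces. *)
Lemma fresh U (Us : seq {vspace V}) n : (\dim U + n <= d)%N -> (size Us < d)%N ->
  all (fun U => (\dim U < d)%N) Us ->
  exists ws, [/\ size ws = n, outside U ws, {in ws, forall w, B 1 w} &
    {in ws, forall w, all (fun U : {vspace V} => w \notin U) Us}].
Proof.
move=> + sUs dUs; elim: n => [|n IH] dU; first by exists [::].
have [|ws [sws ows Bws aws]] := IH; first by apply: leq_trans dU; rewrite addnS.
case: (@avoid ((U + <<ws>>)%VS :: Us)) => //=.
  rewrite dUs andbT (leq_trans _ dU) // addnS ltnS (leq_trans (dimv_add_leqif _ _).1) //.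
  by rewrite leq_add2l -sws dim_span.
move=> y By /andP[yU yUs]; exists (y :: ws); split; rewrite /= ?sws ?yU //.
  by move=> w; rewrite inE => /orP[/eqP->|/Bws].
by move=> w; rewrite inE => /orP[/eqP->|/aws].
Qed.

(** A new point outside the span of the old ones has independent differences with them, so
    [extend_compat] gives it a value. With s + 1 points, compatibility with them determines further
    values modulo the quadric. *)
Lemma base_points n : (n <= s.+1)%N -> exists xs (T : V -> S), [/\ size xs = n, free xs,
  {in xs, forall x, B 1 x /\ HP s (T x)} & {in xs &, forall x y, compat x (T x) y (T y)}].
Proof.
elim: n => [|n IH] ns; first by exists [::], (fun=> 0); rewrite nil_free.
have [xs [T [sxs fxs HT CT]]] := IH (ltnW ns).
have [y By /andP[yxs _]] : exists2 y, B 1 y & all (fun U : {vspace V} => y \notin U) [:: <<xs>>%VS].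
  apply: avoid; first by move: sd; rewrite /=; lia.
  by rewrite /= andbT (leq_ltn_trans (dim_span _)) // sxs; lia.
have fyxs : free (y :: xs) by rewrite free_cons yxs.
have [||t Ht Ct] := extend_compat (T := T) (B1m By) (free_shift fyxs).
- by move=> x /HT[/B1m].
- exact: CT.
have xy x : x \in xs -> (x == y) = false.
  by move=> xxs; apply: contraNF yxs => /eqP<-; exact: memv_span.
exists (y :: xs), (fun x => if x == y then t else T x); split=> //.
- by rewrite /= sxs.
- move=> x; rewrite inE => /orP[/eqP->|xxs]; rewrite ?eqxx //.
  by rewrite xy //; exact: HT.
move=> x x'; rewrite !inE => /orP[/eqP->|xxs] /orP[/eqP->|xxs']; rewrite ?eqxx ?xy //.
- exact: compat_refl.
- exact: Ct.
- by apply: compat_sym (Ct x xxs); apply: B1m => //; have [] := HT x xxs.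
- exact: CT.
Qed.

(* [T] is first defined off the span of some base points, by the Chinese remainder theorem
   at those points; near the span the values are recovered from other, generic points. *)
Lemma global_section : exists T : V -> S, (forall h, B m h -> HP s (T h)) /\
  (forall h h', B m h -> B m h' -> compat h (T h) h' (T h')).
Proof.
have [xs [T0 [sxs fxs HT0 CT0]]] := base_points (leqnn _).
pose W := <<xs>>%VS.
have dW : (\dim W <= s.+1)%N by rewrite -sxs dim_span.
have Bxs : {in xs, forall x, B m x} by move=> x /HT0[/B1m].
have /choice[T1 HT1] : forall h, exists t, B m h -> h \notin W ->
    HP s t /\ {in xs, forall x, compat h t x (T0 x)}.
  move=> h.
  have [hg|hg] := boolP (`[< B m h >] && (h \notin W)); last first.
    by exists 0 => Bh hW; case/negP: hg; rewrite hW andbT; apply/asboolP.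
  case/andP: hg => /asboolP Bh hW.
  have [||t Ht Ct] := extend_compat (T := T0) Bh (xs := xs) _ _ CT0.
  - by apply: free_shift; rewrite free_cons hW.
  - by move=> x xxs; split; [exact: Bxs|have [] := HT0 x xxs].
  by exists t.
(* [G h t] says that [t] is compatible with [T1] at generic points. Two such values have s + 1
   generic points in common, which makes them compatible with each other. *)
pose G h t := exists U : {vspace V}, (\dim U < d)%N /\
  (forall w, B 1 w -> w \notin U -> w \notin W -> compat h t w (T1 w)).
have GG h t h' t' : h != h' -> B m h -> B m h' -> HP s t -> HP s t' -> G h t -> G h' t' ->
    compat h t h' t'.
  move=> hh' Bh Bh' Ht Ht' [U [dU GU]] [U' [dU' GU']].
  have dhh' : (\dim <<[:: h; h']>> <= 2)%N by exact: dim_span.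
  have [|||ws [sws ows Bws]] := fresh (U := <<[:: h; h']>>%VS) (Us := [:: U; U'; W]) (n := s.+1).
  - by lia.
  - by rewrite /=; lia.
  - by rewrite /= dU dU' andbT; lia.
  move=> aws.
  have hU : h \in <<[:: h; h']>>%VS by rewrite memv_span ?mem_head.
  have hU' : h' \in <<[:: h; h']>>%VS by rewrite memv_span // !inE eqxx orbT.
  apply: (compat_of_common (xs := ws) (T := T1)) => //; first by rewrite sws.
  - by move=> w /Bws/B1m.
  - apply: (free_outside ows) => //; first by rewrite seq1_free subr_eq0.
    by rewrite span_seq1 -memvE; apply: rpredB.
  - move=> w wws; have /and4P[wU _ wW _] := aws w wws.
    by apply: GU => //; exact: Bws.
  - move=> w wws; have /and4P[_ wU wW _] := aws w wws.
    by apply: GU' => //; exact: Bws.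
have CT1 h h' : B m h -> B m h' -> h \notin W -> h' \notin W -> compat h (T1 h) h' (T1 h').
  move=> Bh Bh' hW hW'.
  have G1 k : B m k -> k \notin W -> G k (T1 k).
    move=> Bk kW; exists <<k :: xs>>%VS; split.
      by rewrite (leq_ltn_trans (dim_span _)) //= sxs; lia.
    move=> w Bw wk wW; have [Hk Ck] := HT1 k Bk kW; have [Hw Cw] := HT1 w (B1m Bw) wW.
    apply: (compat_of_common (xs := xs) (T := T0)) => //; first exact: B1m.
      by rewrite sxs.
    apply: free_rcons_shift => //; apply: free_shift.
    by rewrite free_cons kW.
  have [<-|hh'] := eqVneq h h'; first exact: compat_refl.
  have [Hh _] := HT1 h Bh hW; have [Hh' _] := HT1 h' Bh' hW'.
  by apply: GG => //; exact: G1.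
(* Any [h], in [W] or not, gets its value from s + 1 fresh points off [W], where [T1] is already
   known to be consistent. *)
have /choice[T HT] : forall h, exists t, B m h -> HP s t /\ G h t.
  move=> h.
  have [/asboolP Bh|nBh] := boolP (`[< B m h >]); last first.
    by exists 0 => Bh; case/negP: nBh; apply/asboolP.
  have [|||us [sus ous Bus aus]] := fresh (U := <[h]>%VS) (Us := [:: W]) (n := s.+1).
  - by rewrite dim_vline; case: (h != 0); lia.
  - by rewrite /=; lia.
  - by rewrite /= andbT; lia.
  have usW u : u \in us -> u \notin W by move=> /aus/andP[].
  have fus : free [seq h - u | u <- us].
    rewrite -[X in free X]cats0; apply: (free_outside ous) => //; rewrite ?nil_free //.
      by rewrite span_nil sub0v.
    exact: memv_line.
  have [||t Ht Ct] := extend_compat (T := T1) Bh fus.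
  - by move=> u uus; split; [exact/B1m/Bus|have [] := HT1 u (B1m (Bus u uus)) (usW u uus)].
  - by move=> u u' uus uus'; apply: CT1; rewrite ?usW //; exact/B1m/Bus.
  exists t => _; split=> //; exists <<h :: us>>%VS; split.
    by rewrite (leq_ltn_trans (dim_span _)) //= sus; lia.
  move=> w Bw wus wW; have [Hw _] := HT1 w (B1m Bw) wW.
  apply: (compat_of_common (xs := us) (T := T1)) => //; first exact: B1m.
  - by rewrite sus.
  - by move=> u /Bus/B1m.
  - exact: free_rcons_shift.
  - by move=> u uus; apply: CT1; [exact: B1m|exact/B1m/Bus|exact: wW|exact: usW].
exists T; split=> [h /HT[] //|h h' Bh Bh'].
have [<-|hh'] := eqVneq h h'; first exact: compat_refl.
have [Hh Gh] := HT h Bh; have [Hh' Gh'] := HT h' Bh'.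
exact: GG.
Qed.

(** * Iterated differences and Newton interpolation *)

Fixpoint dif (f : V -> S) ks z : S :=
  if ks is k :: ks' then dif f ks' (z + k) - dif f ks' z else f z.

Lemma dif_split (f : V -> S) pre h k ks z :
  dif f (pre ++ h :: ks) z = dif f (pre ++ (h - k) :: ks) (z + k) + dif f (pre ++ k :: ks) z.
Proof.
elim: pre z => /= [|a pre IH] z.
  have -> : z + k + (h - k) = z + h by rewrite (addrC h) addrA addrK.
  ring.
by rewrite !IH (addrAC z k a); ring.
Qed.

Fixpoint ndif (f : nat -> S) n i : S := if n is n'.+1 then ndif f n' i.+1 - ndif f n' i else f i.

Lemma ndifSr (f : nat -> S) n i : ndif f n.+1 i = ndif (fun j => f j.+1 - f j) n i.
Proof. by elim: n i => //= n IH i; rewrite -!IH. Qed.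

(** Newton's formula modulo the quadric, by induction on n through the first difference and on i
    through Pascal's rule. [M] limits it to the range where the differences are controlled. *)
Lemma newton_forward (f : nat -> S) n M :
  (forall i, (i + n <= M)%N -> J [::] (ndif f n i)) ->
  forall i, (i <= M)%N -> J [::] (f i - \sum_(l < n) ndif f l 0 *+ 'C(i, l)).
Proof.
elim: n M f => [|n IH] M f Jf i iM.
  by rewrite big_ord0 subr0; apply: (Jf i); rewrite addn0.
elim: i iM => [|i IHi] iM.
  rewrite big_ord_recl bin0 mulr1n big1 => [|l _]; first by rewrite addr0 subrr.
  by rewrite lift0 bin0n.
case: M Jf iM IHi => // M Jf iM IHi.
have Jd : J [::] ((f i.+1 - f i) - \sum_(l < n) ndif f l.+1 0 *+ 'C(i, l)).
  under eq_bigr => l _ do rewrite ndifSr.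
  apply: (IH M (fun j => f j.+1 - f j)) => // j jM.
  by rewrite -ndifSr; apply: Jf; rewrite addnS.
have -> : f i.+1 - \sum_(l < n.+1) ndif f l 0 *+ 'C(i.+1, l) =
  (f i - \sum_(l < n.+1) ndif f l 0 *+ 'C(i, l)) +
  ((f i.+1 - f i) - \sum_(l < n) ndif f l.+1 0 *+ 'C(i, l)).
  rewrite !big_ord_recl !bin0; under eq_bigr => l _ do rewrite /= add0n binS mulrnDr.
  rewrite big_split /= ; ring.
by apply: JD => //; apply: IHi; exact: ltnW.
Qed.

(** * The linear part of a global section *)

Section Linearization.
Variable T : V -> S.
Hypothesis T_homog : forall h, B m h -> HP s (T h).
Hypothesis T_compat : forall h h', B m h -> B m h' -> compat h (T h) h' (T h').

Lemma T_shift z k : B m z -> B m (z + k) -> J [:: k] (T (z + k) - T z - phi k).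
Proof. by move=> Bz Bzk; have := T_compat Bzk Bz; rewrite /compat addrC addKr. Qed.

(** Here and below [a] measures the base point and [b] each step; the inequality keeps all arguments
    of [T] in [B m]. *)
Lemma dif_homog a b ks z : B a z -> {in ks, forall k, B b k} -> (a + b * size ks <= m)%N ->
  HP s (dif T ks z).
Proof.
elim: ks a z => [|k ks IH] a z Bz Bks /= le_m.
  by apply: T_homog; apply: B_le Bz; move: le_m; lia.
have Bk : B b k by apply: Bks; rewrite mem_head.
have Bks' : {in ks, forall k, B b k} by move=> x xks; apply: Bks; rewrite inE xks orbT.
by apply: HPB; [apply: (IH (a + b)%N); [exact: BD|by []|lia] | apply: (IH a) => //; lia].
Qed.

(** A shift by [k] changes T by phi(k) modulo L_k, whatever the base point, so a single difference
    already removes this term. *)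
Lemma dif_shift a b k ks z : B a z -> B b k -> {in ks, forall k, B b k} ->
  (a + b * (size ks).+1 <= m)%N ->
  J [:: k] (dif T ks (z + k) - dif T ks z - (if ks is [::] then phi k else 0)).
Proof.
elim: ks a z => [|k' ks IH] a z Bz Bk Bks le_m.
  apply: T_shift; first by apply: B_le Bz; lia.
  by apply: B_le (BD Bz Bk); move: le_m; rewrite /= ; lia.
have Bk' : B b k' by apply: Bks; rewrite mem_head.
have Bks' : {in ks, forall k, B b k} by move=> x xks; apply: Bks; rewrite inE xks orbT.
have J1 : J [:: k] (dif T ks (z + k' + k) - dif T ks (z + k') - (if ks is [::] then phi k else 0)).
  by apply: (IH (a + b)%N) => //; [exact: BD|move: le_m; rewrite /=; lia].
have J2 : J [:: k] (dif T ks (z + k) - dif T ks z - (if ks is [::] then phi k else 0)).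
  by apply: (IH a) => //; move: le_m; rewrite /=; lia.
rewrite /= (addrAC z); move: J1 J2; set e := (X in _ - X) => J1 J2.
set A1 := dif T ks (z + k' + k) in J1 *; set A2 := dif T ks (z + k') in J1 *.
set A3 := dif T ks (z + k) in J2 *; set A4 := dif T ks z in J2 *.
have -> : A1 - A3 - (A2 - A4) - 0 = (A1 - A2 - e) - (A3 - A4 - e) by ring.
exact: JB.
Qed.

Lemma dif_mem a b k ks z : B a z -> {in ks, forall k, B b k} -> (a + b * size ks <= m)%N ->
  (1 < size ks)%N -> k \in ks -> J [:: k] (dif T ks z).
Proof.
elim: ks a z => [//|k' ks IH] a z Bz Bks le_m sks kks.
have Bk' : B b k' by apply: Bks; rewrite mem_head.
have Bks' : {in ks, forall k, B b k} by move=> x xks; apply: Bks; rewrite inE xks orbT.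
move: kks; rewrite inE => /orP[/eqP kk'|kks].
  have := dif_shift Bz Bk' Bks'; rewrite -kk' => /(_ le_m).
  by case: (ks) sks => // k'' ks' _; rewrite subr0.
move: le_m sks IH Bks' kks; case: ks {Bks} => [|k1 [|k2 ks]] // le_m _ IH Bks'.
  (* With two directions and [k] last, the tail is too short for the induction hypothesis; the two
     copies of phi(k) cancel directly. *)
  rewrite inE => /eqP kk1; subst k1.
  have J1 : J [:: k] (T (z + k' + k) - T (z + k') - phi k).
    have Bzk' : B (a + b) (z + k') by exact: BD.
    apply: T_shift; first by apply: B_le Bzk'; move: le_m; rewrite /=; lia.
    by apply: B_le (BD Bzk' (Bks' k (mem_head _ _))); move: le_m; rewrite /=; lia.
  have J2 : J [:: k] (T (z + k) - T z - phi k).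
    apply: T_shift; first by apply: B_le Bz; move: le_m; rewrite /=; lia.
    by apply: B_le (BD Bz (Bks' k (mem_head _ _))); move: le_m; rewrite /=; lia.
  have -> : dif T [:: k'; k] z =
    (T (z + k' + k) - T (z + k') - phi k) - (T (z + k) - T z - phi k) by rewrite /=; ring.
  exact: JB.
move=> kks; apply: JB.
  by apply: (IH (a + b)%N) => //; [exact: BD|move: le_m; rewrite /=; lia].
by apply: (IH a) => //; move: le_m; rewrite /=; lia.
Qed.

(** The difference vanishes modulo L_k for each of its directions k, more than its degree s. Order s
    + 2 also supplies, when s = 0, the two directions that [dif_mem] asks for. *)
Lemma dif_free a b ks z : B a z -> {in ks, forall k, B b k} -> (a + b * s.+2 <= m)%N ->
  size ks = s.+2 -> free ks -> J [::] (dif T ks z).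
Proof.
move=> Bz Bks le_m sks fks; apply: (@vanish [::] ks s) => //.
- by apply: dif_homog Bz Bks _; rewrite sks.
- by rewrite sks.
- by move=> k kks; apply: dif_mem Bz Bks _ _ kks; rewrite sks.
- exact: free_pairwise2.
Qed.

(* Each step [h] is split as [k + (h - k)] with generic [k], which reduces equal
   directions to independent ones. *)
Lemma dif_nseq a b h z : B a z -> B b h -> (a + s.+2 + b.+1 * s.+2 <= m)%N ->
  J [::] (dif T (nseq s.+2 h) z).
Proof.
move=> Bz Bh le_m.
pose choice ms ks := all2 (fun m k : V => (m == k) || (m == h - k)) ms ks.
have [|||ks [sks oks Bks _]] := fresh (U := <[h]>%VS) (Us := [::]) (n := s.+2) => //.
- by rewrite dim_vline; case: (h != 0); lia.
- by rewrite /=; lia.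
have hh : h \in <[h]>%VS by rewrite memv_line.
(* As [ks] is independent modulo [h], replacing some k by h - k preserves independence. *)
have cfree ms : choice ms ks -> free ms /\ (<<ms>> <= <[h]> + <<ks>>)%VS.
  elim: (ks) ms oks => [|k l IH] [|w ms] //=; first by rewrite nil_free span_nil sub0v.
  move=> /andP[kl /IH{}IH] /andP[wk /IH[fms sms]].
  have hl : h \in (<[h]> + <<k :: l>>)%VS by rewrite (subvP (addvSl _ _)).
  have kl' : k \in (<[h]> + <<k :: l>>)%VS.
    by rewrite (subvP (addvSr _ _)) // memv_span ?mem_head.
  split.
    rewrite free_cons fms andbT; apply: contra kl => /(subvP sms) wl.
    case/orP: wk wl => /eqP-> // hkl; rewrite -[k](subKr h) rpredB //.
    by rewrite (subvP (addvSl _ _)).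
  rewrite span_cons subv_add; apply/andP; split.
    by rewrite -memvE; case/orP: wk => /eqP-> //; rewrite rpredB.
  by rewrite (subv_trans sms) // addvS // span_cons addvSr.
have cB ms : choice ms ks -> {in ms, forall w, B b.+1 w}.
  elim: (ks) ms Bks => [|k l IH] [|w ms] //= Bl /andP[wk /IH{}IH] x.
  have Bk : B 1 k by apply: Bl; rewrite mem_head.
  rewrite inE => /orP[/eqP->|xms].
    case/orP: wk => /eqP->; first by apply: B_le Bk.
    by rewrite -addn1; apply: BD => //; exact: BN.
  by apply: IH => // y yl; apply: Bl; rewrite inE yl orbT.
(* The steps are split from the left, [pre] holding those already treated. Each splitting may move
   the base point by one element of [B 1], whence the bound [c + size l]. *)
have key l pre c y : {in l, forall k, B 1 k} -> B c y ->
    (forall ms c' y', (c' <= c + size l)%N -> choice ms l -> B c' y' ->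
      J [::] (dif T (pre ++ ms) y')) ->
    J [::] (dif T (pre ++ nseq (size l) h) y).
  elim: l pre c y => [|k l IH] pre c y Bl By Jpre.
    by apply: Jpre By; rewrite ?addn0.
  have Bl' : {in l, forall k, B 1 k} by move=> x xl; apply: Bl; rewrite inE xl orbT.
  have Bk : B 1 k by apply: Bl; rewrite mem_head.
  rewrite /= -cat_rcons; apply: IH By _ => // ms c' y' c'c cms By'.
  rewrite cat_rcons (dif_split _ _ _ k); apply: JD.
    apply: (Jpre _ (c' + 1)%N); [by move: c'c; rewrite /=; lia| |exact: BD].
    by rewrite /choice /= eqxx orbT.
  by apply: (Jpre _ c') => //; [move: c'c; rewrite /=; lia|rewrite /choice /= eqxx].
rewrite -sks; apply: (key ks [::] a) => // ms c' y' c'a cms By'.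
apply: dif_free By' (cB ms cms) _ _ _.
- by move: le_m c'a; rewrite sks; lia.
- by rewrite -sks; move: cms; rewrite /choice all2E => /andP[/eqP].
- by have [] := cfree ms cms.
Qed.

Hypothesis charF : forall i, (0 < i < s.+2)%N -> i%:R != 0 :> F.
Hypothesis m_large : (2 * s.+2 * s.+2 + 4 * s.+2 <= m)%N.

Lemma B_mul n x i : B n x -> B (i.+1 * n) (x *+ i.+1).
Proof.
move=> Bx; elim: i => [|i IH]; first by rewrite mul1n mulr1n.
by rewrite mulrS mulSn; exact: BD.
Qed.

Lemma B_muln n x i (k : nat) : B n x -> (i * n <= k)%N -> (0 < k)%N -> B k (x *+ i).
Proof.
move=> Bx ik k0; case: i ik => [|i] ik; first by rewrite mulr0n; exact: B_le B0.
exact: B_le (B_mul i Bx).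
Qed.

Lemma difT_ndif h l i : dif T (nseq l h) (h *+ i) = ndif (fun j => T (h *+ j)) l i.
Proof. by elim: l i => //= l IH i; rewrite -mulrSr !IH. Qed.

(** The range (s + 2)^2 contains all products j i that occur when the coefficient of T is computed
    along the multiple j h. *)
Lemma T_newton h i : B 2 h -> (i <= s.+2 * s.+2)%N ->
  J [::] (T (h *+ i) - \sum_(l < s.+2) ndif (fun j => T (h *+ j)) l 0 *+ 'C(i, l)).
Proof.
move=> Bh; apply: (@newton_forward (fun j => T (h *+ j)) s.+2 (s.+2 * s.+2)) => j jM.
(* A base point of size 2 (s + 2)^2 and steps of size 2 turn the bound of [dif_nseq] into
   [m_large]. *)
rewrite -difT_ndif; apply: (@dif_nseq (2 * s.+2 * s.+2) 2) => //.
  by apply: B_muln Bh _ _; nia.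
by move: m_large; lia.
Qed.

Lemma phi_mul k i : B (4 * s.+2) k -> (i <= s.+2)%N -> J [:: k] (phi (k *+ i) - phi k *+ i).
Proof.
move=> Bk; elim: i => [|i IH] is2; first by rewrite !mulr0n subr0; apply/J_nil/phi0.
have kX : k \in <<[:: k]>>%VS by rewrite memv_span ?mem_head.
have Bki j : (j <= s.+2)%N -> B (m + m) (k *+ j).
  by move=> js; apply: B_muln Bk _ _; move: m_large; nia.
have := phi_add (Bki 1%N isT) (Bki i (ltnW is2)); rewrite mulr1n -mulrS => /(_ (Bki _ is2)).
move=> /(J_span2 kX (rpredMn _ kX)) J1.
have -> : phi (k *+ i.+1) - phi k *+ i.+1 =
   (phi (k *+ i.+1) - phi k - phi (k *+ i)) + (phi (k *+ i) - phi k *+ i).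
  by rewrite mulrS; ring.
by apply: JD => //; apply: IH; exact: ltnW.
Qed.

Lemma J_sum I (r : seq I) (P : pred I) (f : I -> S) hs :
  (forall i, P i -> J hs (f i)) -> J hs (\sum_(i <- r | P i) f i).
Proof. by move=> Jf; elim/big_ind: _ => //; exact: JD. Qed.

(* [C h] is the coefficient of [i] in the polynomial sequence [T (i h)]: this operator
   leaves the additive part of [T] unchanged and kills the other homogeneous components,
   which [T_compat] does not rule out. *)
Lemma homogeneous_section : exists C : V -> S, [/\
  forall h, B (2 * s.+2) h -> HP s (C h),
  forall h h', B (2 * s.+2) h -> B (2 * s.+2) h' -> compat h (C h) h' (C h') &
  forall h j, B 2 h -> (j <= s.+2)%N -> J [::] (C (h *+ j) - C h *+ j)].
Proof.
have [alpha [beta [alpha1 alphaC]]] := linear_coefficient charF isT.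
have Bm h i : B (2 * s.+2) h -> (i < s.+2)%N -> B m (h *+ i).
  by move=> Bh is2; apply: B_muln Bh _ _; move: m_large; nia.
exists (fun h => \sum_(i < s.+2) alpha i *: T (h *+ i)); split.
- move=> h Bh; elim/big_ind: _ => [||i _]; [exact: HP0|exact: HPD|].
  by apply/HPZ/T_homog/Bm.
(* Modulo L_{h-h'}, T(ih) - T(ih') equals i phi(h - h'), and the weights satisfy sum_i alpha_i i =
   1. *)
- move=> h h' Bh Bh'; rewrite /compat -[phi _]scale1r -alpha1 scaler_suml -!sumrB.
  apply: J_sum => i _; rewrite -scalerA scaler_nat -!scalerBr; apply: JZ.
  have := T_compat (Bm h i Bh (ltn_ord i)) (Bm h' i Bh' (ltn_ord i)).
  rewrite /compat -mulrnBl => J1.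
  have -> : T (h *+ i) - T (h' *+ i) - phi (h - h') *+ i = (T (h *+ i) - T (h' *+ i) -
    phi ((h - h') *+ i)) + (phi ((h - h') *+ i) - phi (h - h') *+ i) by ring.
  apply: JD; first by apply: J_span1 J1; apply/rpredMn/memv_span/mem_head.
  apply: phi_mul; last exact: ltnW.
  have -> : (4 * s.+2 = 2 * s.+2 + 2 * s.+2)%N by lia.
  by apply: BD => //; exact: BN.
move=> h j Bh js2; pose w l := ndif (fun i => T (h *+ i)) l 0.
(* Newton's formula along multiples of [h] makes C(j' h) linear in j'; the values j' = j and j' = 1
   are then compared. *)
have key j' : (j' <= s.+2)%N ->
    J [::] (\sum_(i < s.+2) alpha i *: T (h *+ j' *+ i) -
            \sum_(l < s.+2) (j'%:R * beta l) *: w l).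
  move=> j's2.
  have -> : \sum_(l < s.+2) (j'%:R * beta l) *: w l =
      \sum_(i < s.+2) alpha i *: \sum_(l < s.+2) w l *+ 'C(j' * i, l).
    under [RHS]eq_bigr => i _ do rewrite scaler_sumr.
    rewrite exchange_big; apply: eq_bigr => l _ /=.
    rewrite -alphaC // scaler_suml; apply: eq_bigr => i _.
    by rewrite -scalerA scaler_nat.
  rewrite -sumrB; apply: J_sum => i _; rewrite -scalerBr -mulrnA; apply/JZ/T_newton => //.
  by rewrite leq_mul // ltnW.
have -> : \sum_(i < s.+2) alpha i *: T (h *+ j *+ i) -
     (\sum_(i < s.+2) alpha i *: T (h *+ i)) *+ j =
   (\sum_(i < s.+2) alpha i *: T (h *+ j *+ i) - \sum_(l < s.+2) (j%:R * beta l) *: w l) -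
   j%:R *: (\sum_(i < s.+2) alpha i *: T (h *+ 1 *+ i) - \sum_(l < s.+2) (1%:R * beta l) *: w l).
  rewrite scalerBr !scaler_nat.
  have -> : (\sum_(l < s.+2) (1%:R * beta l) *: w l) *+ j =
      \sum_(l < s.+2) (j%:R * beta l) *: w l.
    rewrite -sumrMnl; apply: eq_bigr => l _.
    by rewrite mul1r -scalerA scaler_nat.
  by rewrite mulr1n; ring.
by apply: JB; [exact: key|apply: JZ; exact: key].
Qed.

End Linearization.

(** * An additive map that agrees with phi modulo L_h *)

Lemma additive_correction :
  (forall i, (0 < i < s.+2)%N -> i%:R != 0 :> F) ->
  (2 * s.+2 * s.+2 + 4 * s.+2 <= m)%N ->
  exists C : V -> S, [/\ forall h, B 1 h -> HP s (C h),
    forall h, B 1 h -> J [:: h] (C h - phi h) &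
    forall h k, B 1 h -> B 1 k -> J [::] (C (h + k) - C h - C k)].
Proof.
move=> charF m_large; have [T [T_homog T_compat]] := global_section.
have [C [C_homog C_compat C_mul]] := homogeneous_section T_homog T_compat charF m_large.
have B12 h : B 1 h -> B 2 h by exact: B_le.
have Bn n h : (n <= 2 * s.+2)%N -> B n h -> B (2 * s.+2) h by move=> ?; exact: B_le.
have C0 : J [::] (C 0).
  by have := C_mul 0 0%N (B12 _ B0) isT; rewrite !mulr0n subr0.
exists C; split.
- by move=> h Bh; apply/C_homog/(Bn 1%N).
- move=> h Bh; have := C_compat _ _ (Bn 1%N h isT Bh) (Bn 1%N 0 isT B0).
  rewrite /compat subr0 => Jh; have -> : C h - phi h = (C h - C 0 - phi h) + C 0 by ring.
  by apply: JD => //; exact: J_nil.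
have Cfree h k : B 2 h -> B 2 k -> free [:: h; k] -> J [::] (C (h + k) - C h - C k).
  move=> Bh Bk fhk.
  have Bhk : B (2 * s.+2) (h + k) by apply: (Bn 4%N) => //; [lia|exact: (@BD 2 2)].
  have Bh' : B (2 * s.+2) h by apply: (Bn 2%N) => //; lia.
  have Bki i : (i <= s.+2)%N -> B (2 * s.+2) (k *+ i).
    by move=> is2; apply: B_muln Bk _ _; lia.
  apply: (@vanish [::] [seq h - k *+ i | i <- iota 0 s.+1] s) => //.
  - apply: HPB; first by apply: HPB; exact: C_homog.
    by apply: C_homog; have := Bki 1%N isT; rewrite mulr1n.
  - by rewrite size_map size_iota.
  - move=> x /mapP[i]; rewrite mem_iota add0n => /andP[_ is1] ->.
    have is2 : (i.+1 <= s.+2)%N := leqW is1.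
    have J1 := C_compat _ _ Bhk (Bki i.+1 is2); have J2 := C_compat _ _ Bh' (Bki i (ltnW is2)).
    have J3 := J_nil [:: h - k *+ i] (C_mul k i.+1 Bk is2).
    have J4 := J_nil [:: h - k *+ i] (C_mul k i Bk (ltnW is2)).
    have hk : h + k - k *+ i.+1 = h - k *+ i by rewrite mulrS opprD addrA addrK.
    move: J1 J2; rewrite /compat hk => J1 J2.
    have -> : C (h + k) - C h - C k =
      (C (h + k) - C (k *+ i.+1) - phi (h - k *+ i)) - (C h - C (k *+ i) - phi (h - k *+ i)) +
      ((C (k *+ i.+1) - C k *+ i.+1) - (C (k *+ i) - C k *+ i)) by rewrite (mulrS (C k)); ring.
    by apply: JD; exact: JB.
  - rewrite pairwise_map; have := iota_uniq 0 s.+1; rewrite uniq_pairwise.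
    apply: (@sub_in_pairwise _ (fun i => i < s.+1)%N); last by apply/allP => i; rewrite mem_iota.
    move=> i j is1 js1 ij; rewrite !unfold_in in is1 js1; rewrite /= in ij *.
    (* Since j - i is invertible, h - ik and h - jk span both k and h, so they are independent. *)
    have cij : (j%:R - i%:R : F) != 0.
      case: (ltngtP i j) ij => // ij _; last rewrite -opprB oppr_eq0.
        by rewrite -natrB ?(ltnW ij) // charF // subn_gt0 ij; lia.
      by rewrite -natrB ?(ltnW ij) // charF // subn_gt0 ij; lia.
    apply: (free_of_span fhk) => //; set X := <<_>>%VS.
    have hi : h - k *+ i \in X by rewrite memv_span ?mem_head.
    have hj : h - k *+ j \in X by rewrite memv_span // !inE eqxx orbT.
    have kX : k \in X.
      rewrite -[k](scalerK cij) scalerBl !scaler_nat rpredZ //.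
      have -> : k *+ j - k *+ i = (h - k *+ i) - (h - k *+ j).
        by rewrite opprB [RHS]addrC addrA subrK.
      by rewrite rpredB.
    move=> x; rewrite !inE => /orP[]/eqP-> //.
    by rewrite -[h](subrK (k *+ i)) rpredD // rpredMn.
move=> h k Bh Bk; have [->|h0] := eqVneq h 0.
  by rewrite add0r addrAC subrr sub0r; exact: JN.
have [->|k0] := eqVneq k 0.
  by rewrite addr0 subrr sub0r; exact: JN.
(* For arbitrary h and k a generic y makes the pairs (h, k + y), (k, y) and (h + k, y) independent
   unless a vector vanishes; combining the three additivity relations eliminates y. *)
have [y By /andP[yhk _]] : exists2 y, B 1 y &
    all (fun U : {vspace V} => y \notin U) [:: <<[:: h; k]>>%VS].
  apply: avoid; first by rewrite /=; lia.
  by rewrite /= andbT (leq_ltn_trans (dim_span _)) //=; lia.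
have hX : h \in <<[:: h; k]>>%VS by rewrite memv_span ?mem_head.
have kX : k \in <<[:: h; k]>>%VS by rewrite memv_span // !inE eqxx orbT.
have fr x z : x != 0 -> x \in <<[:: h; k]>>%VS -> z \in <<[:: h; k]>>%VS -> free [:: x; z + y].
  move=> x0 xX zX; rewrite (perm_free (Y := [:: z + y; x])); last first.
    by rewrite (perm_catC [:: x] [:: z + y]).
  rewrite free_cons seq1_free x0 andbT span_seq1; apply: contra yhk => /vlineP[c zy].
  by rewrite -[y](addKr z) zy rpredD ?memvN ?rpredZ.
have B2 x z : B 1 x -> B 1 z -> B 2 (x + z) by exact: (@BD 1 1).
have J1 := Cfree h (k + y) (B12 _ Bh) (B2 _ _ Bk By) (fr _ _ h0 hX kX).
have J2 := Cfree k (0 + y) (B12 _ Bk) (B2 _ _ B0 By) (fr _ _ k0 kX (mem0v _)).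
have J3 : J [::] (C (h + k + y) - C (h + k) - C y).
  have [->|hk0] := eqVneq (h + k) 0; first by rewrite add0r addrAC subrr sub0r; exact: JN.
  have := Cfree _ (0 + y) (B2 _ _ Bh Bk) (B2 _ _ B0 By) (fr _ _ hk0 (rpredD hX kX) (mem0v _)).
  by rewrite add0r.
move: J1 J2; rewrite add0r addrA => J1 J2.
have -> : C (h + k) - C h - C k = (C (h + k + y) - C h - C (k + y)) + (C (k + y) - C k - C y) -
  (C (h + k + y) - C (h + k) - C y) by ring.
by apply: JB => //; exact: JD.
Qed.

End IdealFamily.

(** * Arithmetic progressions and their dilates *)

Section Progressions.
Variables (p d D : nat) (R : realType) (v : 'I_D -> 'rV['F_p]_d) (L : 'I_D -> R).
Hypothesis L_gt0 : GAP_params L.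
Implicit Types (c : R) (l : 'I_D -> int).

Lemma gap_eltD l l' : gap_elt v (fun i => l i + l' i) = gap_elt v l + gap_elt v l'.
Proof. by rewrite -big_split; apply: eq_bigr => i _; rewrite mulrzDr. Qed.

Lemma inGAP_D c c' x y : inGAP v L c x -> inGAP v L c' y -> inGAP v L (c + c') (x + y).
Proof.
move=> [l [al ->]] [l' [al' ->]]; exists (fun i => l i + l' i); split; last by rewrite gap_eltD.
by move=> i; rewrite intrD mulrDl (le_lt_trans (ler_normD _ _)) // ltrD.
Qed.

Lemma inGAP_N c x : inGAP v L c x -> inGAP v L c (- x).
Proof.
move=> [l [al ->]]; exists (fun i => - l i); split.
  by move=> i; rewrite rmorphN normrN; exact: al.
by rewrite /gap_elt -sumrN; apply: eq_bigr => i _; rewrite mulrNz.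
Qed.

Lemma inGAP_le c c' x : c <= c' -> inGAP v L c x -> inGAP v L c' x.
Proof.
move=> cc' [l [al ->]]; exists l; split=> // i.
by rewrite (lt_le_trans (al i)) // ler_wpM2r // ltW.
Qed.

Lemma inGAP_restrict c l (r : seq 'I_D) : 0 < c -> uniq r ->
  (forall i, i \in r -> `|(l i)%:~R| < c * L i) -> inGAP v L c (\sum_(i <- r) v i *~ l i).
Proof.
move=> c0 ur al; exists (fun i => if i \in r then l i else 0); split.
  by move=> i; case: ifP => [/al //|_]; rewrite normr0 mulr_gt0.
rewrite big_uniq //= /gap_elt [LHS]big_mkcond; apply: eq_bigr => i _.
by case: ifP; rewrite ?mulr0z.
Qed.

Lemma inGAP0 c : 0 < c -> inGAP v L c 0.
Proof.
move=> c0; rewrite -(big_nil 0 +%R xpredT (fun i : 'I_D => v i *~ 0)).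
exact: inGAP_restrict.
Qed.

Lemma inGAP_single c i (k : int) : 0 < c -> `|k%:~R| < c * L i -> inGAP v L c (v i *~ k).
Proof.
move=> c0 kL; rewrite -(big_seq1 +%R i (fun i => v i *~ k)).
by apply: (inGAP_restrict (l := fun=> k)) => // j; rewrite inE => /eqP->.
Qed.

Lemma ex_nat_ceil (x : R) : 0 < x -> exists2 w : nat, (w%:R < x) & x <= w.+1%:R.
Proof.
move=> x0; have: exists n : nat, x <= n%:R.
  by exists (Num.bound x); rewrite ltW // archi_boundP // ltW.
case/ex_minnP => -[|w] xw minw; first by move: x0; rewrite ltNge xw.
by exists w => //; rewrite ltNge; apply/negP => /minw; rewrite ltnn.
Qed.

(** P is covered by (2N)^D translates of P(1/N): divide each coordinate by w_i + 1, the ceiling of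
    L_i / N. The quotient lies in [-N, N) and the remainder is at most w_i < L_i / N. *)
Lemma card_GAP_cover N : (0 < N)%N ->
  (#|GAPset v L 1| <= (2 * N) ^ D * #|GAPset v L N%:R^-1|)%N.
Proof.
move=> N0; have N0R : 0 < N%:R :> R by rewrite ltr0n.
have /choice[w wP] : forall i, exists w : nat, w%:R < L i / N%:R /\ L i / N%:R <= w.+1%:R.
  by move=> i; have [|w wL Lw] := @ex_nat_ceil (L i / N%:R); [exact: divr_gt0|exists w].
pose shift (q : {ffun 'I_D -> 'I_(2 * N)}) := \sum_i v i *~ (((q i : nat)%:Z - N%:Z) * (w i).+1%:Z).
pose g (qy : {ffun 'I_D -> 'I_(2 * N)} * 'rV['F_p]_d) := shift qy.1 + qy.2.
have -> : ((2 * N) ^ D = #|[set: {ffun 'I_D -> 'I_(2 * N)}]|)%N.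
  by rewrite cardsT card_ffun !card_ord.
rewrite -cardsX (leq_trans _ (leq_imset_card g _)) //.
apply/subset_leq_card/subsetP => x; rewrite inE => /asboolP[l [al ->]].
have dl i : l i = divz (l i) (w i).+1 * (w i).+1 + modz (l i) (w i).+1 by exact: divz_eq.
have ml i : 0 <= modz (l i) (w i).+1 < (w i).+1%:Z by rewrite modz_ge0 // ltz_pmod.
have bl i : - (N * (w i).+1)%N%:Z < l i < (N * (w i).+1)%N%:Z.
  rewrite -ltr_norml -(ltr_int R) intr_norm (lt_le_trans (al i)) // mul1r.
  by have [_] := wP i; rewrite ler_pdivrMr // mulrC -natrM.
have ql i : 0 <= divz (l i) (w i).+1 + N < (2 * N)%N%:Z.
  by have := dl i; have := ml i; have := bl i; move: (divz _ _) (modz _ _) => q r; nia.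
have qE i : (absz (divz (l i) (w i).+1 + N%:Z)%R < 2 * N)%N.
  by have /andP[q0 qN] := ql i; rewrite -ltz_nat gez0_abs.
apply/imsetP; exists ([ffun i => Ordinal (qE i)], gap_elt v (fun i => modz (l i) (w i).+1)).
  rewrite !inE /=; apply/asboolP; exists (fun i => modz (l i) (w i).+1); split=> // i.
  have /andP[m0 mw] := ml i; have [wL _] := wP i.
  rewrite ger0_norm ?ler0z // mulrC (le_lt_trans _ wL) // -[leRHS]/((w i)%:Z%:~R) ler_int.
  by move: mw; rewrite -addn1 PoszD ltzD1.
rewrite /g /= /shift -gap_eltD; apply: eq_bigr => i _.
rewrite ffunE /= gez0_abs; last by have /andP[] := ql i.
by rewrite addrK -dl.
Qed.

End Progressions.

(** * Dense progressions: avoiding subspaces, and additive maps on them *)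

Section DenseProgressions.
Variables (p d D : nat) (R : realType) (v : 'I_D -> 'rV['F_p]_d) (L : 'I_D -> R).
Hypothesis L_gt0 : GAP_params L.
Hypothesis p_pr : prime p.

(** By the covering, P(1/N) has more than delta p^d / (2N)^D points, whereas d proper subspaces
    contain at most d p^(d-1). *)
Lemma GAP_avoid N (delta : R) (Us : seq {vspace 'rV['F_p]_d}) : (0 < N)%N -> (0 < d)%N ->
  delta * (p ^ d)%:R < #|GAPset v L 1|%:R -> ((2 * N) ^ D * d)%:R <= delta * p%:R ->
  (size Us <= d)%N -> all (fun U => (\dim U < d)%N) Us ->
  exists2 y, inGAP v L N%:R^-1 y & all (fun U : {vspace 'rV['F_p]_d} => y \notin U) Us.
Proof.
move=> N0 d0 dense large sUs dUs; apply: contrapT => none.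
have sub : GAPset v L N%:R^-1 \subset \bigcup_(U <- Us) [set y in U].
  apply/subsetP => y; rewrite inE => /asboolP Py; apply: contrapT => yU.
  apply: none; exists y => //; apply/allP => U UUs; apply/negP => yU'.
  by apply: yU; rewrite (big_rem U) //= !inE yU'.
have bound : (#|GAPset v L N%:R^-1| <= d * p ^ d.-1)%N.
  apply: leq_trans (subset_leq_card sub) _.
  apply: (@leq_trans (size Us * p ^ d.-1)); last by rewrite leq_mul2r sUs orbT.
  elim: Us dUs {sUs sub none} => [|U Us IH] /=; first by rewrite big_nil cards0.
  move=> /andP[dU /IH{}IH]; rewrite big_cons mulSn (leq_trans (leq_card_setU _ _)) //.
  rewrite leq_add // cardsE card_vspace card_Fp // leq_exp2l ?prime_gt1 //.
  by rewrite -ltnS prednK.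
have := card_GAP_cover v L_gt0 N0.
move=> /leq_trans /(_ (leq_mul (leqnn _) bound)); rewrite -(ler_nat R).
move=> /(lt_le_trans dense); apply/negP; rewrite -leNgt mulnA natrM.
by rewrite -(prednK d0) expnS [(p * _)%:R]natrM mulrA ler_wpM2r // prednK.
Qed.

Variables (A : 'M['F_p]_d) (c : R) (C : 'rV['F_p]_d -> {mpoly 'F_p[d]}).
Hypothesis c_gt0 : 0 < c.
Hypothesis C_add : forall h k, inGAP v L c h -> inGAP v L c k ->
  inJ A [::] (C (h + k) - C h - C k).

Lemma inJN hs f : inJ A hs f -> inJ A hs (- f).
Proof. by move=> Jf; rewrite -mulN1r; exact: inJM. Qed.

Lemma inJB hs f g : inJ A hs f -> inJ A hs g -> inJ A hs (f - g).
Proof. by move=> Jf Jg; apply: inJD => //; exact: inJN. Qed.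

Lemma almost_additive0 : inJ A [::] (C 0).
Proof.
have B0 := inGAP0 v L_gt0 c_gt0; have := C_add B0 B0.
by rewrite addr0 subrr sub0r => /inJN; rewrite opprK.
Qed.

(** If c L_i <= 1, the only admissible l_i is 0 and v_i may lie outside P(c), where C is not
    controlled; the default 0 keeps the coefficient homogeneous. *)
Let coef i : {mpoly 'F_p[d]} := if `[< 1 < c * L i >] then C (v i) else 0.

Lemma almost_additive_mulz i (k : int) : `|k%:~R| < c * L i ->
  inJ A [::] (C (v i *~ k) - coef i *~ k).
Proof.
have nonneg (n : nat) : n%:R < c * L i -> inJ A [::] (C (v i *+ n) - coef i *+ n).
  elim: n => [|n IH] nL; first by rewrite !mulr0n subr0; exact: almost_additive0.
  have L1 : 1 < c * L i by apply: le_lt_trans nL; rewrite ler1n.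
  have nL' : n%:R < c * L i by apply: le_lt_trans nL; rewrite ler_nat.
  have Bn : inGAP v L c (v i *+ n).
    by apply: (inGAP_single v L_gt0 (k := n%:Z)) => //; rewrite normr_nat.
  have B1 : inGAP v L c (v i).
    by apply: (inGAP_single v L_gt0 (k := 1)) => //; rewrite normr1.
  have E : coef i = C (v i) by rewrite /coef asboolT.
  have -> : C (v i *+ n.+1) - coef i *+ n.+1 =
      (C (v i *+ n.+1) - C (v i) - C (v i *+ n)) + (C (v i *+ n) - coef i *+ n).
    by rewrite mulrS (mulrS (coef i)) E opprD !addrA subrK.
  by apply: inJD; [rewrite mulrS; exact: C_add|exact: IH].
case: k => n; first by rewrite normr_nat; exact: nonneg.
rewrite NegzE mulrNz normrN normr_nat => nL.
have Bn : inGAP v L c (v i *+ n.+1).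
  by apply: (inGAP_single v L_gt0 (k := n.+1%:Z)) => //; rewrite normr_nat.
have J1 := C_add Bn (inGAP_N Bn); rewrite subrr in J1.
rewrite mulrNz.
have -> : C (- (v i *~ n.+1)) - - (coef i *~ n.+1) =
    C 0 - (C 0 - C (v i *+ n.+1) - C (- (v i *+ n.+1))) - (C (v i *+ n.+1) - coef i *+ n.+1).
  rewrite -!pmulrn.
  have ringE (K : comNzRingType) (a b e f : K) : e - - f = a - (a - b - e) - (b - f) by ring.
  exact: ringE.
apply: inJB; last exact: nonneg.
by apply: inJB; [exact: almost_additive0|exact: J1].
Qed.

(** Coordinates are added one at a time; partial sums stay in P(c) because the missing coordinates
    are zero. *)
Lemma almost_additive_gap l : admissible L c l ->
  inJ A [::] (C (gap_elt v l) - \sum_i coef i *~ l i).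
Proof.
move=> al.
suff key (r : seq 'I_D) : uniq r ->
    inJ A [::] (C (\sum_(i <- r) v i *~ l i) - \sum_(i <- r) coef i *~ l i).
  by apply: key; rewrite index_enum_uniq.
elim: r => [|i r IH] /=; first by rewrite !big_nil subr0 => _; exact: almost_additive0.
move=> /andP[ir ur]; rewrite !big_cons.
set x := v i *~ l i; set y := \sum_(j <- r) v j *~ l j.
set a := coef i *~ l i; set b := \sum_(j <- r) coef j *~ l j.
have J1 : inJ A [::] (C (x + y) - C x - C y).
  by apply: C_add; [exact: inGAP_single|apply: inGAP_restrict => // j _; exact: al].
have -> : C (x + y) - (a + b) = (C (x + y) - C x - C y) + ((C x - a) + (C y - b)).
  by rewrite (addrACA (C x)) -opprD addrA -[C (x + y) - C x - C y]addrA -opprD subrK.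
apply: inJD; first exact: J1.
by apply: inJD; [exact: almost_additive_mulz|exact: IH].
Qed.

End DenseProgressions.

Theorem theorem4p3 (R : realType) :
  exists c : nat -> R, (forall s, 0 < c s <= 1) /\
  forall (d D : nat) (delta : R), (0 < d)%N -> (0 < D)%N -> 0 < delta ->
  exists p0 : nat, forall (s p : nat), (maxn (s + 10) 11 <= d)%N ->
    prime p -> (p0 <= p)%N ->
    forall (A : 'M['F_p]_d) (u : 'rV['F_p]_d) (w : 'F_p),
      A^T = A -> \det A != 0 ->
    forall (v : 'I_D -> 'rV['F_p]_d) (L : 'I_D -> R),
      GAP_params L -> proper_GAP v L ->
      (#|GAPset v L 1|)%:R > delta * (p ^ d)%:R ->
    forall xi : 'rV['F_p]_d -> {mpoly 'F_p[d]},
      (forall h, inGAP v L 1 h -> HP s (xi h)) ->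
      (forall h1 h2 h3 h4, inGAP v L 1 h1 -> inGAP v L 1 h2 ->
         inGAP v L 1 h3 -> inGAP v L 1 h4 -> h1 + h2 = h3 + h4 ->
         inJ A [:: h1; h2; h3] (xi h1 + xi h2 - xi h3 - xi h4)) ->
    exists T : 'rV['F_p]_d -> {mpoly 'F_p[d]},
      locally_linear s v L (c s) T /\
      (forall h, inGAP v L (c s) h -> HP s (T h)) /\
      (forall h, inGAP v L (c s) h -> inJ A [:: h] (xi h - T h)).
Proof.
(* 6 (s + 2)^2 dominates the bound [m_large]. With c = 1 / N and N = 2 m, the sets [B 1] and
   [B (m + m)] are P(c) and P. *)
pose m s := (6 * s.+2 * s.+2)%N; pose N s := (m s + m s)%N.
have m0 s : (0 < m s)%N by [].
have N0 s : (0 < N s)%N by [].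
have NR s : 0 < (N s)%:R :> R by rewrite ltr0n.
have c0 s : 0 < (N s)%:R^-1 :> R by rewrite invr_gt0.
have c1 s : (N s)%:R^-1 <= 1 :> R by rewrite invf_le1 ?NR // ler1n.
exists (fun s => (N s)%:R^-1); split=> [s|d D delta]; first by rewrite c0 c1.
move=> d0 D0 delta0.
(* [N d] replaces [N s], as p_0 must not depend on s; s <= d makes it large enough. The summand d in
   p_0 forces p >= s + 10. *)
pose K := ((2 * N d) ^ D * d)%N.
exists (Num.bound (K%:R / delta) + d)%N.
move=> s p sd p_pr pp0 A u w A_sym A_det v L L_gt0 v_proper dense xi xi_homog xi_quad.
have {}sd : (s + 10 <= d)%N by move: sd; rewrite geq_max => /andP[].
have pd : (d <= p)%N by apply: leq_trans pp0; exact: leq_addl.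
have p_odd : (2 < p)%N by lia.
have pK : ((2 * N s) ^ D * d)%:R <= delta * p%:R :> R.
  apply: (@le_trans _ _ K%:R).
    by rewrite ler_nat leq_mul2r leq_exp2r // leq_mul2l /N /m; apply/orP; right; nia.
  rewrite mulrC -ler_pdivrMr // ltW // (lt_le_trans (archi_boundP _)) ?divr_ge0 ?(ltW delta0) //.
  by rewrite ler_nat (leq_trans _ pp0) // leq_addr.
pose B n := inGAP v L (n%:R / (N s)%:R).
have BN1 x : B (m s + m s)%N x <-> inGAP v L 1 x by rewrite /B divff // gt_eqF.
have B1c x : B 1%N x <-> inGAP v L (N s)%:R^-1 x by rewrite /B mul1r.
pose phi h := xi h - xi 0.
have P0 : inGAP v L 1 0 by exact: inGAP0.
have charF i : (0 < i < s.+2)%N -> i%:R != 0 :> 'F_p.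
  move=> /andP[i0 is2]; rewrite -(dvdn_pcharf (pchar_Fp p_pr)) gtnNdvd //; lia.
have phi_add a b : B (m s + m s)%N a -> B (m s + m s)%N b -> B (m s + m s)%N (a + b) ->
    inJ A [:: a; b] (phi (a + b) - phi a - phi b).
  move=> /BN1 Pa /BN1 Pb /BN1 Pab.
  (* The hypothesis for a + b = (a + b) + 0 holds modulo J_{a,b,a+b}, which is J_{a,b} since a + b
     is in the span of a and b. *)
  have := xi_quad a b (a + b) 0 Pa Pb Pab P0; rewrite addr0 => /(_ erefl) /inJN Jab.
  have ringE (E : comNzRingType) (x y z t : E) :
    (z - t) - (x - t) - (y - t) = - (x + y - z - t) by ring.
  rewrite ringE; apply: inJ_span Jab => x; rewrite !inE => /or3P[]/eqP->.
  - by rewrite memv_span ?mem_head.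
  - by rewrite memv_span // !inE eqxx orbT.
  - by apply: rpredD; rewrite memv_span // !inE eqxx ?orbT.
have Bc n n' x y : B n x -> B n' y -> B (n + n')%N (x + y).
  by move=> Bx By; rewrite /B natrD mulrDl; exact: inGAP_D.
have B_le n n' x : (n <= n')%N -> B n x -> B n' x.
  by move=> nn'; apply: inGAP_le => //; rewrite ler_wpM2r ?ler_nat // ltW.
have [C [C_homog C_phi C_add]] : exists C : 'rV['F_p]_d -> {mpoly 'F_p[d]},
    [/\ forall h, B 1%N h -> C h \is s.-homog,
      forall h, B 1%N h -> inJ A [:: h] (C h - phi h) &
      forall h k, B 1%N h -> B 1%N k -> inJ A [::] (C (h + k) - C h - C k)].
  refine (@additive_correction 'F_p 'rV['F_p]_d {mpoly 'F_p[d]}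
    (fun t f => f \is t.-homog) (lin_part A) (inJ A)
    _ _ _ _ _ _ _ _ _ _ _ _ _ s d (m s) B phi sd (m0 s) _ Bc _ B_le _ _ phi_add charF _).
  - by move=> t; exact: rpred0.
  - by move=> t f g; exact: rpredD.
  - by move=> t a f; exact: rpredZ.
  - by move=> t t' f g; exact: dhomogM.
  - by move=> h; exact: lform_homog.
  - exact: dhomog1.
  - exact: inJ0.
  - exact: inJD.
  - exact: inJM.
  - by move=> hs h hhs; apply: inJ_lin; exact: memv_span.
  - exact: inJ_span.
  - exact: inJ_cons.
  (* At most three forms occur together, so cancellation asks for 6 < d. *)
  - move=> h hs f s2; apply: inJ_regular => //.
    by apply: (@leq_ltn_trans (2 * 3)); [rewrite leq_pmul2l | lia].
  - by rewrite B1c; exact: inGAP0.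
  - by move=> n x; exact: inGAP_N.
  - move=> Us sUs dUs; have [y Py yUs] := GAP_avoid L_gt0 p_pr (N0 s) d0 dense pK sUs dUs.
    by exists y => //; apply/B1c.
  - by move=> h /BN1 Ph; apply: rpredB; exact: xi_homog.
  - by rewrite /m; nia.
pose coef i : {mpoly 'F_p[d]} := if `[< 1 < (N s)%:R^-1 * L i >] then C (v i) else 0.
have C_add' h k : inGAP v L (N s)%:R^-1 h -> inGAP v L (N s)%:R^-1 k ->
    inJ A [::] (C (h + k) - C h - C k) by move=> /B1c Bh /B1c Bk; exact: C_add.
have gapC l := almost_additive_gap L_gt0 (c0 s) C_add' (l := l).
have coef_homog i : coef i \is s.-homog.
  rewrite /coef; case: asboolP => [vL|_]; last exact: rpred0.
  by apply: C_homog; apply/B1c/(inGAP_single v L_gt0 (k := 1)); rewrite ?normr1.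
pose lin l := xi 0 + \sum_i coef i *~ l i.
(* Properness makes admissible coordinates unique, so [lin] descends to points of P(c). *)
have /choice[T TE] : forall h, exists t, forall l, admissible L (N s)%:R^-1 l ->
    h = gap_elt v l -> t = lin l.
  move=> h; have [[l [al hl]]|nh] := pselect (inGAP v L (N s)%:R^-1 h); last first.
    by exists 0 => l al hl; case: nh; exists l.
  exists (lin l) => l' al'; rewrite hl => ll'.
  have adm1 l0 : admissible L (N s)%:R^-1 l0 -> admissible L 1 l0.
    by move=> a0 i; rewrite (lt_le_trans (a0 i)) // ler_wpM2r ?c1 // ltW.
  congr (_ + _); apply: eq_bigr => i _.
  by rewrite (v_proper l l' (adm1 l al) (adm1 l' al') ll' i).
exists T; split; [|split].
- exists (fun i => if unlift ord0 i is Some j then coef j else xi 0); split=> [i|l al].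
    by rewrite /HP; case: unliftP => [j _|_]; [exact: coef_homog|exact: xi_homog].
  rewrite (TE _ l al erefl) unlift_none; congr (_ + _); apply: eq_bigr => i _.
  by rewrite liftK.
- move=> h [l [al hl]]; rewrite (TE h l al hl) /HP; apply: rpredD; first exact: xi_homog.
  by apply: rpred_sum => i _; apply: rpredMz; exact: coef_homog.
move=> h Ph; have [l [al hl]] := Ph.
(* xi(h) - T(h) is the error of C against its linear formula, zero modulo the quadric, minus C(h) -
   phi(h), zero modulo L_h and the quadric. *)
have ringE (E : comNzRingType) (x y z t : E) : x - (y + z) = (t - z) - (t - (x - y)) by ring.
rewrite (TE h l al hl) /lin (ringE _ _ _ _ (C h)); apply: inJB; last by apply/C_phi/B1c.
by have := gapC l al; rewrite -hl; exact: inJ_span.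
Qed.
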